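(* Let $N\subset U$ be an isotropic subspace. (1) The quotient space $U'=N^\perp/N$ inherits from $\beta$ an orthogonal (non-degenerate symmetric bilinear) form, with dimension and discriminant given by $$\dim U'=\dim U-2\dim N,\qquad d(U')=(-1)^{\dim N}d(U).$$ (2) The stabilizer group $O_N\subset O(U)$ of $N$ acts on $U'$, and the maps on $U'$ that arise this way are exactly the elements of $O(U')$. (3) The restriction of $\mu_{U\otimes V}$ to $O_N\times\mathrm{Sp}(V)$ acts on (i.e. preserves) the tensor power CSS code $C_N$. As a representation of $O(U')\times\mathrm{Sp}(V)$ (with $O_N$ acting through its homomorphism onto $O(U')$), this restriction to $C_N$ is equivalent to $\mu_{U'\otimes V}$.
   Context: Notation. $q$ is a power of an odd prime $p$. For $\lambda\in\mathbb{F}_q^\times$, $\ell_\lambda=+1$ if $\lambda$ is a square and $-1$ otherwise. $\omega(\lambda)=\exp\big(\tfrac{2\pi i}{p}\mathrm{Tr}(\lambda)\big)$ with $\mathrm{Tr}:\mathbb{F}_q\to\mathbb{F}_p$ the field trace. For a finite set $S$, $L^2(S)$ is the Hilbert space of complex functions on $S$, and $\delta_s$ is the indicator function of $s\in S$. The transpose of a linear map $A$ is $A^t$. A map $A:Y^*\to Y$ is symmetric if $A=A^t$; one writes $A(y,y')=y'(Ay)$. Oscillator representation. For a finite-dimensional $\mathbb{F}_q$-space $Y$, $Y\oplus Y^*$ carries the symplectic form $[x\oplus y,x'\oplus y']=y'(x)-y(x')$. The oscillator representation $\mu_{Y\oplus Y^*}$ of $\mathrm{Sp}(Y\oplus Y^*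 )$ on $L^2(Y^* )$ is the representation determined on generators by $\mu(N_A)\delta_y=\omega(2^{-1}A(y,y))\,\delta_y$, $\ \mu(D_C)\delta_y=\ell_{\det C}\,\delta_{C^{-t}y}$, $\ \mu(J_B)\delta_y=\gamma(B)^{-1}\sum_{y'\in Y^*}\omega(B(y,y'))\,\delta_{y'}$, where $N_A=\begin{pmatrix}1&A\\0&1\end{pmatrix}$ ($A:Y^*\to Y$ symmetric), $D_C=\begin{pmatrix}C&0\\0&C^{-t}\end{pmatrix}$ ($C\in GL(Y)$), $J_B=\begin{pmatrix}0&B\\-B^{-1}&0\end{pmatrix}$ ($B:Y^*\to Y$ symmetric invertible), and $\gamma(B)=\sum_{y\in Y^*}\omega(-2^{-1}B(y,y))$. Setting. $X$ is an $n$-dimensional $\mathbb{F}_q$-space and $V=X\oplus X^*$. $U$ is a $t$-dimensional $\mathbb{F}_q$-space with a non-degenerate symmetric bilinear form $\beta$. Its discriminant $d(U)$ is the square class in $\mathbb{F}_q^\times$ of the determinant of the Gram matrix of any basis. For any such orthogonal space $U$ (also for $U'$), $U\otimes V=(U\otimes X)\oplus(U\otimes X^* )$ is symplectic, the two summands being dual via $\langle u\otimes x,v\otimes y\rangle=\beta(u,v)y(x)$; identifying $U\otimes X^*=\mathrm{Hom}(X\to U)$, $\mu_{U\otimes V}$ acts on $L^2(\mathrm{Hom}(X\to U))$. It is regarded as a representation of $O(U)\times\mathrm{Sp}(V)$ via $(g,S)\mapsto g\otimes S\in\mathrm{Sp}(U\otimes V)$. If $U=0$, it is the one-dimensional trivial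 representation. CSS codes. $N\subset U$ is isotropic if $N\subset N^\perp$. The tensor power CSS code $C_N\subset L^2(\mathrm{Hom}(X\to U))$ is the space of all functions $\Phi$ with $\mathrm{supp}\,\Phi\subset\mathrm{Hom}(X\to N^\perp)$ and $\Phi(F)=\Phi(F')$ whenever $F-F'\in\mathrm{Hom}(X\to N)$. *)

(* Defs.v *)
From HB Require Import structures.
From mathcomp Require Import all_boot all_order all_algebra all_field.
From mathcomp Require Import reals trigo.
From mathcomp Require Import complex.

Set Implicit Arguments.
Unset Strict Implicit.
Unset Printing Implicit Defensive.

Import Order.TTheory GRing.Theory Num.Theory.
Local Open Scope ring_scope.
Local Open Scope quotient_scope.

(* The vector space V / K; {quot K} is the library quotient of V, as an      *)
(* abelian group, by the congruence x - y \in K.                             *)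
Section QuotientSpace.
Variables (F : fieldType) (V : vectType F) (K : {vspace V}).

Definition quotv : Type := Quotient.quot (pred_of_vspace K).

HB.instance Definition _ := GRing.Zmodule.on quotv.
HB.instance Definition _ := EqQuotient.on quotv.

Definition piv (x : V) : quotv := \pi_quotv x.
Definition reprv (a : quotv) : V := repr a.

Lemma reprvK : cancel reprv piv.
Proof. exact: reprK. Qed.

Lemma piv_eq x y : (piv x == piv y) = (x - y \in K).
Proof. by rewrite /piv -Quotient.idealrBE. Qed.

Lemma pivD : {morph piv : x y / x + y}.
Proof. by move=> x y; rewrite /piv /quotv piE. Qed.

Definition scaleqv (c : F) (a : quotv) : quotv := piv (c *: reprv a).

Lemma scaleqvE c x : scaleqv c (piv x) = piv (c *: x).
Proof.
by apply/eqP; rewrite piv_eq -scalerBr memvZ // -piv_eq reprvK.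
Qed.

Lemma scaleqvA a b u : scaleqv a (scaleqv b u) = scaleqv (a * b) u.
Proof. by rewrite -[u]reprvK !scaleqvE scalerA. Qed.
Lemma scaleqv1 : left_id 1 scaleqv.
Proof. by move=> u; rewrite -[u]reprvK scaleqvE scale1r. Qed.
Lemma scaleqvDr : right_distributive scaleqv +%R.
Proof.
by move=> a u v; rewrite -[u]reprvK -[v]reprvK -pivD !scaleqvE scalerDr pivD.
Qed.
Lemma scaleqvDl u : {morph scaleqv^~ u : a b / a + b}.
Proof. by move=> a b; rewrite -[u]reprvK !scaleqvE scalerDl pivD. Qed.

HB.instance Definition _ := GRing.Zmodule_isLmodule.Build F quotv
  scaleqvA scaleqv1 scaleqvDr scaleqvDl.

Lemma piv_is_linear : linear piv.
Proof. by move=> c x y; rewrite pivD -scaleqvE. Qed.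
HB.instance Definition _ := GRing.isLinear.Build F V quotv _ piv piv_is_linear.

Fact quotv_vect_iso : Vector.axiom (\dim (K^C)) quotv.
Proof.
pose e := vbasis (K^C)%VS; pose r : 'End(V) := (\1 - projv K)%VF.
have rE v : r v = v - projv K v by rewrite add_lfunE opp_lfunE id_lfunE.
have rK v : piv (r v) = piv v.
  by apply/eqP; rewrite piv_eq rE addrAC subrr add0r memvN memv_proj.
have r0 v : v \in K -> r v = 0 by move=> Kv; rewrite rE projv_id ?subrr.
have r1 v : v \in (K^C)%VS -> r v = v.
  by rewrite -lker_proj memv_ker rE => /eqP->; rewrite subr0.
have rP v w : piv v = piv w -> r v = r w.
  by move/eqP; rewrite piv_eq => /r0/eqP; rewrite linearB subr_eq0 => /eqP.
have rC v : r v \in (K^C)%VS by rewrite rE memv_projC.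
pose f (a : quotv) := \row_i coord e i (r (reprv a)).
have fl : linear f.
  move=> c a b; apply/rowP=> i; rewrite !mxE -linearP; congr (coord e i _).
  by rewrite -linearP; apply: rP; rewrite piv_is_linear !reprvK.
exists f; first exact: fl.
exists (fun v : 'rV_(\dim K^C) => piv (\sum_(i < \dim K^C) v 0 i *: e`_i)) => [a|v].
  rewrite -[RHS]reprvK -(rK (reprv a)) [in RHS](coord_vbasis (rC _)).
  by congr piv; apply: eq_bigr => i _; rewrite mxE.
apply/rowP=> i; rewrite mxE (rP _ _ (reprvK _)) r1; last first.
  by apply: memv_suml => j _; rewrite memvZ // vbasis_mem // mem_nth ?size_tuple.
by rewrite coord_sum_free // (basis_free (vbasisP _)).
Qed.
HB.instance Definition _ := Lmodule_hasFinDim.Build F quotv quotv_vect_iso.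
End QuotientSpace.

Lemma linfunE (F : fieldType) (V W : vectType F) (f : V -> W) :
  linear f -> linfun f =1 f.
Proof.
move=> fl x; pose m := GRing.isLinear.Build F V W *:%R f fl.
pose ff : {linear V -> W} := HB.pack f m.
exact: (lfunE ff).
Qed.

Section CharacterAndSign.
Variables (R : realType) (F : finFieldType) (p : nat) (pF : p \in [pchar F]).

(* galTrace is valued in the prime line of F; its coordinate on 1 is the     *)
(* corresponding element of 'F_p, see Fp_traceE.                             *)
Definition Fp_trace (a : F) : 'F_p :=
  let L := pPrimeCharType pF in
  coord [tuple (1 : L)] ord0 (galTrace 1 {:L} a).

Lemma Fp_traceE (a : F) :
  galTrace 1 {: pPrimeCharType pF} a = (Fp_trace a : nat)%:R :> F.
Proof.
have : galTrace 1 {: pPrimeCharType pF} a \in 1%VS.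
  by apply: mem_galTrace (memvf _); exact: finField_galois (sub1v _).
case/vlineP=> k kE.
have c1 : coord [tuple (1 : pPrimeCharType pF)] ord0 1 = 1.
  have := coord_free (X := [tuple (1 : pPrimeCharType pF)]) ord0 ord0.
  by apply; rewrite seq1_free oner_eq0.
have cE : Fp_trace a = k * 1 by rewrite /Fp_trace kE linearZ; congr (k * _); exact: c1.
by rewrite cE mulr1 kE [LHS]mulr1.
Qed.

Definition omega (a : F) : R[i] :=
  let theta : R := 2 * pi * (Fp_trace a : nat)%:R / p%:R in
  (cos theta +i* sin theta)%C.

Definition ell (a : F) : R[i] := if [exists b : F, a == b ^+ 2] then 1 else -1.

End CharacterAndSign.

Definition same_square_class (F : fieldType) (a b : F) : Prop :=
  exists2 c : F, c != 0 & a = c ^+ 2 * b.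

Definition dual (F : fieldType) (V : vectType F) := 'Hom(V, F^o).

Definition evp (F : fieldType) (V : vectType F) (x : V) (f : dual V) : F := f x.

Definition lfun_det (F : fieldType) (V : vectType F) (C : 'End(V)) : F :=
  \det (passmx.mxof (vbasis {:V}) (vbasis {:V}) C).

(* L^2(Z), the complex functions on the finite set underlying Z.             *)
Definition L2 (R : realType) (F : finFieldType) (Z : vectType F) :=
  {ffun finvect_type Z -> R[i]^o}.

Definition delta (R : realType) (F : finFieldType) (Z : vectType F) (z : Z) :
  L2 R Z := [ffun z' : finvect_type Z => ((z' : Z) == z)%:R].

(* Y and Y' are dual to each other through the pairing pr; the case          *)
(* Y' = dual Y, pr = evp is the tautological one.                            *)
Section Oscillator.
Variables (R : realType) (F : finFieldType) (p : nat) (pF : p \in [pchar F]).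
Variables (Y Y' : vectType F) (pr : Y -> Y' -> F).

Definition symp_form (w w' : Y * Y') : F := pr w.1 w'.2 - pr w'.1 w.2.

Definition Sp (S : 'End((Y * Y')%type)) : Prop :=
  lker S = 0%VS /\ forall w w', symp_form (S w) (S w') = symp_form w w'.

Definition sym_map (A : 'Hom(Y', Y)) : Prop :=
  forall y y' : Y', pr (A y) y' = pr (A y') y.

Definition invertible_map (V W : vectType F) (A : 'Hom(V, W)) : Prop :=
  lker A = 0%VS /\ limg A = fullv.

(* Ct is the inverse transpose of C                                          *)
Definition contragredient (C : 'End(Y)) (Ct : 'End(Y')) : Prop :=
  forall (x : Y) (y : Y'), pr (C x) (Ct y) = pr x y.

Definition N_ (A : 'Hom(Y', Y)) : 'End((Y * Y')%type) :=
  linfun (fun w : Y * Y' => (w.1 + A w.2, w.2)).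
Definition D_ (C : 'End(Y)) (Ct : 'End(Y')) : 'End((Y * Y')%type) :=
  linfun (fun w : Y * Y' => (C w.1, Ct w.2)).
Definition J_ (B : 'Hom(Y', Y)) : 'End((Y * Y')%type) :=
  linfun (fun w : Y * Y' => (B w.2, - (B^-1)%VF w.1)).

Lemma N_E A w : N_ A w = (w.1 + A w.2, w.2).
Proof.
rewrite linfunE // => c u v /=; rewrite linearP.
by congr pair; rewrite /= scalerDr addrACA.
Qed.

Lemma D_E C Ct w : D_ C Ct w = (C w.1, Ct w.2).
Proof. by rewrite linfunE // => c u v /=; rewrite !linearP. Qed.

Lemma J_E B w : J_ B w = (B w.2, - (B^-1)%VF w.1).
Proof.
by rewrite linfunE // => c u v /=; rewrite !linearP.
Qed.

Definition gamma (B : 'Hom(Y', Y)) : R[i] :=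
  \sum_(y : finvect_type Y') omega R pF (- (2%:R^-1 * pr (B y) y)).

Definition oscillator (mu : 'End((Y * Y')%type) -> 'End(L2 R Y')) : Prop :=
  [/\ mu \1%VF = \1%VF,
      forall S S', Sp S -> Sp S' -> mu (S \o S')%VF = (mu S \o mu S')%VF,
      forall A, sym_map A -> forall y,
        mu (N_ A) (delta R y) = omega R pF (2%:R^-1 * pr (A y) y) *: delta R y,
      forall C Ct, invertible_map C -> contragredient C Ct -> forall y,
        mu (D_ C Ct) (delta R y) = ell R (lfun_det C) *: delta R (Ct y)
    & forall B, sym_map B -> invertible_map B -> forall y,
        mu (J_ B) (delta R y) =
          (gamma B)^-1 *:
            \sum_(y' : finvect_type Y') omega R pF (pr (B y) y') *: delta R y'].

End Oscillator.

(* U (x) X is realised as Hom(X^*, U), with u (x) x the map f |-> f x *: u,  *)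
(* and U (x) X^* as Hom(X, U), with u (x) f the map x |-> f x *: u.          *)
Section Tensor.
Variables (F : finFieldType) (U X : vectType F) (beta : {symmetric U}).

Notation UX := 'Hom(dual X, U).
Notation UXd := 'Hom(X, U).

Definition tensX (u : U) (x : X) : UX := linfun (fun f : dual X => f x *: u).
Definition tensXd (u : U) (f : dual X) : UXd := linfun (fun x : X => f x *: u).
Definition tensV (u : U) (v : X * dual X) : UX * UXd :=
  (tensX u v.1, tensXd u v.2).

Let e := vbasis {:X}.
Definition dual_vbasis (i : 'I_(\dim {:X})) : dual X := linfun (coord e i : X -> F^o).

(* As w.1 = \sum_i w.1 e_i^* (x) e_i and w.2 = \sum_i w.2 e_i (x) e_i^*, the *)
(* next two definitions are the linear extensions of the formulas on pure    *)
(* tensors stated in tens_pairE and tens_actE.                               *)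
Definition tens_pair (a : UX) (b : UXd) : F :=
  \sum_i beta (a (dual_vbasis i)) (b e`_i).

Definition tens_act (g : 'End(U)) (S : 'End((X * dual X)%type)) :
    'End((UX * UXd)%type) :=
  linfun (fun w : UX * UXd =>
    \sum_i (tensV (g (w.1 (dual_vbasis i))) (S (e`_i, 0))
          + tensV (g (w.2 e`_i)) (S (0, dual_vbasis i)))).

Lemma tensXE u x f : tensX u x f = f x *: u.
Proof.
by rewrite linfunE // => c f1 f2; rewrite add_lfunE scale_lfunE scalerDl scalerA.
Qed.

Lemma tensXdE u f x : tensXd u f x = f x *: u.
Proof.
by rewrite linfunE // => c x1 x2; rewrite linearP scalerDl scalerA.
Qed.

Lemma tensX_linear u : linear (tensX u).
Proof.
move=> c x y; apply/lfunP=> f.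
by rewrite add_lfunE scale_lfunE !tensXE linearP scalerDl scalerA.
Qed.

Lemma tensXd_linear u : linear (tensXd u).
Proof.
move=> c f g; apply/lfunP=> x.
by rewrite add_lfunE scale_lfunE !tensXdE add_lfunE scale_lfunE scalerDl scalerA.
Qed.

Lemma tensX_linearl x : linear (tensX^~ x).
Proof.
move=> c u v; apply/lfunP=> f.
by rewrite add_lfunE scale_lfunE !tensXE scalerDr !scalerA mulrC.
Qed.

Lemma tensXd_linearl f : linear (tensXd^~ f).
Proof.
move=> c u v; apply/lfunP=> x.
by rewrite add_lfunE scale_lfunE !tensXdE scalerDr !scalerA mulrC.
Qed.

Lemma tensV_linear u : linear (tensV u).
Proof. by move=> c v w; rewrite /tensV /= tensX_linear tensXd_linear. Qed.

Lemma tensV_linearl v : linear (tensV^~ v).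
Proof. by move=> c u w; rewrite /tensV /= tensX_linearl tensXd_linearl. Qed.

Lemma dual_vbasisE i x : dual_vbasis i x = coord e i x.
Proof. by rewrite /dual_vbasis lfunE. Qed.

Lemma vbasis_sum x : x = \sum_(i < \dim {:X}) coord e i x *: e`_i.
Proof. exact/coord_vbasis/memvf. Qed.

Lemma dual_vbasis_sum (f : dual X) : f = \sum_(i < \dim {:X}) (f e`_i : F) *: dual_vbasis i.
Proof.
apply/lfunP=> x; rewrite {1}[x]vbasis_sum linear_sum sum_lfunE.
apply: eq_bigr => i _; rewrite linearZ scale_lfunE dual_vbasisE.
exact: mulrC.
Qed.

Lemma tens_pairE u x v f :
  tens_pair (tensX u x) (tensXd v f) = beta u v * evp x f.
Proof.
rewrite /tens_pair /evp {2}[x]vbasis_sum linear_sum mulr_sumr.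
apply: eq_bigr => i _; rewrite tensXE tensXdE dual_vbasisE !linearZ /=.
by rewrite linearZl_LR /= mulrCA mulrA mulrC.
Qed.

Lemma tens_actE g S u v : tens_act g S (tensV u v) = tensV (g u) (S v).
Proof.
rewrite /tens_act linfunE => [|c w1 w2]; last first.
  rewrite scaler_sumr -big_split; apply: eq_bigr => i _ /=.
  rewrite !add_lfunE !scale_lfunE !linearP !tensV_linearl scalerDr.
  by rewrite addrACA.
have Zl c w v' : tensV (c *: w) v' = tensV w (c *: v').
  rewrite /tensV; congr pair; apply/lfunP=> z.
    by rewrite !tensXE /= (linearZ_LR z) scalerA mulrC.
  by rewrite !tensXdE scale_lfunE scalerA mulrC.
pose Tg : 'Hom((X * dual X)%type, (UX * UXd)%type) := linfun (tensV (g u)).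
have TgE (w : X * dual X) : Tg w = tensV (g u) w by rewrite linfunE //; apply: tensV_linear.
have defv : v = \sum_(i < \dim {:X})
    (coord e i v.1 *: (e`_i, 0) + (v.2 e`_i : F) *: (0, dual_vbasis i)).
  case: v => x f /=; rewrite big_split /=.
  have -> : \sum_(i < \dim {:X}) coord e i x *: (e`_i, 0 : dual X) = (x, 0).
    rewrite {2}[x]vbasis_sum; apply/esym.
    by elim/big_rec2: _ => // i y z _ <-; rewrite /= -[RHS]/(_, _) /= scaler0 addr0.
  have -> : \sum_(i < \dim {:X}) (f e`_i : F) *: (0 : X, dual_vbasis i) = (0, f).
    rewrite {2}[f]dual_vbasis_sum; apply/esym.
    by elim/big_rec2: _ => // i y z _ <-; rewrite /= -[RHS]/(_, _) /= scaler0 addr0.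
  by rewrite -[RHS]/(_, _) /= addr0 add0r.
transitivity (Tg (S v)); last exact: TgE.
rewrite [v in RHS]defv !linear_sum; apply: eq_bigr => i _ /=.
have TgD (c d : F) (x y : X * dual X) : Tg (S (c *: x + d *: y)) =
    tensV (c *: g u) (S x) + tensV (d *: g u) (S y).
  by rewrite !Zl -!TgE -linearD; congr (Tg _); rewrite linearD !linearZ.
rewrite TgD tensXE tensXdE dual_vbasisE; congr (tensV _ _ + tensV _ _).
  exact: linearZ.
exact: linearZ.
Qed.

End Tensor.

Section QuotientForm.
Variables (F : finFieldType) (U : vectType F) (beta : {symmetric U}).
Variable N : {vspace U}.

Definition perp : {vspace U} := orthov beta N.

(* N^\perp / N, where N is seen inside the vector space N^\perp              *)
Definition perpq : vectType F :=
  quotv (linfun (vsval : subvs_of perp -> U) @^-1: N)%VS.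

Definition pi_perp (x : subvs_of perp) : perpq := piv _ x.

Definition OrthG (g : 'End(U)) : Prop := lker g = 0%VS /\ isometry beta beta g.

Definition OrthN (g : 'End(U)) : Prop := OrthG g /\ (g @: N)%VS = N.

(* The map induced by g on N^\perp / N, when g preserves N and N^\perp       *)
Definition induced (g : 'End(U)) : 'End(perpq) :=
  linfun (fun a : perpq => pi_perp (vsproj perp (g (vsval (reprv a))))).

Definition CSS (R : realType) (X : vectType F) : {pred L2 R 'Hom(X, U)} :=
  [pred Phi : L2 R 'Hom(X, U) |
     [forall G : finvect_type 'Hom(X, U),
        (Phi G != 0) ==> (limg (G : 'Hom(X, U)) <= perp)%VS]
  && [forall G : finvect_type 'Hom(X, U), forall G' : finvect_type 'Hom(X, U),
        (limg ((G : 'Hom(X, U)) - G')%R <= N)%VS ==> (Phi G == Phi G')]].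

End QuotientForm.

Definition gram (F : fieldType) (V : vectType F) (beta : V -> V -> F)
    (n : nat) (e : n.-tuple V) : 'M[F]_n :=
  \matrix_(i, j) beta e`_i e`_j.

Arguments CSS {F U} beta N R X.
Arguments tens_pair {F U} X beta.
Arguments evp {F} V.

(* Main.v *)
Require Import Defs.
From HB Require Import structures.
From mathcomp Require Import all_boot all_order all_algebra all_field.
From mathcomp Require Import reals trigo.
From mathcomp Require Import complex mxtens ring.

Set Implicit Arguments.
Unset Strict Implicit.
Unset Printing Implicit Defensive.

Import Order.TTheory GRing.Theory Num.Theory.
Local Open Scope ring_scope.

(** Write W for the quotient of N^perp by N. Since beta is nondegenerate, the
    double orthogonal of N is N, so N is the radical of beta on N^perp and beta
    descends to a nondegenerate form on W. A linear section s of N^perp -> W is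
    an isometry, and its adjoint P : U -> W extends the projection to U. Hence
    U is the orthogonal sum of s(W) and of the kernel of P, in which N is its
    own orthogonal: an isometry of W extends by the identity on ker P
    ([induced_surj]), and vectors f_j dual to a basis n_i of N give a basis
    (n, f, s(e')) of U whose Gram determinant is (-1)^(dim N) times that of e'
    ([adapted_basis], [det_gram_adapted]).

    A function of the code is determined by its values at the maps s o z with
    z : X -> W, so restriction along z |-> s o z identifies the code with the
    functions on Hom(X, W) ([restr_inj], [restr_surj]). This identification
    intertwines the two representations. The group Sp(X + X^* ) is generated by
    the N_A, D_C and J_B ([Sp_generated]), and tensoring one of these with U
    gives an operator of the same kind, so three cases suffice.
    - N_A multiplies by a character of a quadratic form which, on maps into
      N^perp, depends only on their classes ([intertwined_diag]).
    - g (x) D_C permutes the delta functions, up to the sign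
      ell (det g ^ dim X * det C ^ dim U). An element g of the stabiliser of N
      and the isometry which it induces on W have the same determinant
      ([det_induced]), and dim U and dim W have the same parity, so the signs on
      both sides agree ([intertwined_D]).
    - J_B is a Fourier transform. Along the cosets of Hom(X, N) its kernel is a
      character, trivial exactly on Hom(X, N^perp); the result is again in the
      code, with a factor equal to the order of Hom(X, N), and the same
      cancellation shows that the normalising Gauss sums differ by this very
      factor ([gamma_proj], [intertwined_fourier]). *)

(** * The additive character *)

(** Dedekind: distinct automorphisms of L are linearly independent, so that
    their sum is not the zero map. *)
Lemma galTrace_neq0 (K : fieldType) (L : splittingFieldType K) :
  exists a : L, galTrace 1 {:L} a != 0.
Proof.
have [a _] := @gal_independent_contra _ _ {:L} [in 'Gal({:L} / 1)%g] (fun=> 1) 1%g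
  (fingroup.group1 _) (oner_neq0 _).
by under eq_bigr do rewrite mul1r; exists a.
Qed.

Section Character.
Variables (R : realType) (F : finFieldType) (p : nat) (pF : p \in [pchar F]).
Notation w := (omega R pF).

Lemma Fp_trace_is_additive : {morph Fp_trace pF : a b / a + b}.
Proof. by move=> a b; rewrite /Fp_trace raddfD linearD. Qed.

Lemma Fp_trace_neq0 : exists a, Fp_trace pF a != 0.
Proof.
have [a nz] := galTrace_neq0 (pPrimeCharType pF); exists a.
apply: contraNneq nz => tr0; apply/eqP.
by rewrite [LHS]Fp_traceE tr0.
Qed.

(** The p-th roots of unity exp (2 i pi k / p). *)
Definition cis (k : nat) : R[i] :=
  let theta : R := 2 * pi * k%:R / p%:R in (cos theta +i* sin theta)%C.

Lemma cisD j k : cis (j + k) = cis j * cis k.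
Proof.
rewrite /cis natrD mulrDr mulrDl cosD sinD.
by apply/eqP; rewrite eq_complex /= eqxx; apply/eqP; ring.
Qed.

Lemma p_gt0 : (0 < p)%N. Proof. exact/prime_gt0/(pcharf_prime pF). Qed.

Lemma cis_p : cis p = 1.
Proof.
have pn0 : (p%:R : R) != 0 by rewrite pnatr_eq0 -lt0n p_gt0.
by rewrite /cis mulfK // mulr_natl cos2pi sin2pi.
Qed.

Lemma cis_mod k : cis (k %% p) = cis k.
Proof.
have cisM q : cis (q * p) = 1.
  elim: q => [|q IHq]; last by rewrite mulSn cisD cis_p IHq mulr1.
  by rewrite /cis mul0n !mulr0 mul0r cos0 sin0.
by rewrite {2}(divn_eq k p) cisD cisM mul1r.
Qed.

(** As 1 - cos (2 t) = 2 sin t ^ 2, it suffices that sin (pi k / p) > 0. *)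
Lemma cis_neq1 k : (0 < k < p)%N -> cis k != 1.
Proof.
case/andP=> k0 kp; rewrite /cis; set th : R := _ / _.
have pp : 0 < (p%:R : R) by rewrite ltr0n p_gt0.
have th2 : th = (pi * k%:R / p%:R) *+ 2 by rewrite /th -[RHS]mulr_natl !mulrA.
have s0 : 0 < sin (pi * k%:R / p%:R : R).
  apply: sin_gt0_pi; rewrite divr_gt0 ?mulr_gt0 ?pi_gt0 ?ltr0n ?p_gt0 //=.
  by rewrite ltr_pdivrMr // ltr_pM2l ?pi_gt0 // ltr_nat.
apply/eqP=> /(congr1 (@complex.Re R)) /=; rewrite th2 cos_mulr2n cos2sin2 => e.
set sn := sin _ in e s0.
have : sn ^+ 2 *+ 2 = 1 - ((1 - sn ^+ 2) *+ 2 - 1) by ring.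
by rewrite e subrr => /eqP; rewrite mulrn_eq0 /= expf_eq0 /= gt_eqF.
Qed.

Lemma omega_cis a : w a = cis (Fp_trace pF a : nat). Proof. by []. Qed.

(** Addition in the prime field reduces representatives modulo p, which the
    p-th roots of unity do not see. *)
Lemma omegaD : {morph w : a b / a + b >-> a * b}.
Proof.
move=> a b; rewrite !omega_cis Fp_trace_is_additive -cisD -[RHS]cis_mod.
by congr cis; apply: (congr1 (modn _) (Fp_cast (pcharf_prime pF))).
Qed.

Lemma omega0 : w 0 = 1.
Proof.
rewrite omega_cis /Fp_trace raddf0 linear0 /cis /= mulr0 mul0r cos0 sin0 //.
Qed.

Lemma omega_nontrivial : exists a, w a != 1.
Proof.
have [a nz] := Fp_trace_neq0; exists a; rewrite omega_cis; apply: cis_neq1.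
rewrite lt0n nz /=; apply: leq_trans (ltn_ord _) _.
by rewrite Fp_cast // (pcharf_prime pF).
Qed.
End Character.

(** * Determinants and Gram matrices in arbitrary bases *)

Lemma ell_square (R : realType) (F : finFieldType) (c a : F) :
  c != 0 -> ell R (c ^+ 2 * a) = ell R a.
Proof.
move=> c0; rewrite /ell; congr (if _ then _ else _).
apply/existsP/existsP=> -[b /eqP e].
  by exists (b / c); rewrite expr_div_n -e mulrAC divff ?mul1r ?expf_neq0.
by exists (c * b); rewrite exprMn e.
Qed.

(** Endomorphisms are given by matrices whose rows are the images of the basis
    vectors; the bases below have an arbitrary length m, which is only provably
    equal to the dimension, so that they may be concatenated. *)
Section Bases.
Variables (F : fieldType) (V : vectType F).

Definition change_mx m (e f : m.-tuple V) : 'M[F]_m :=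
  \matrix_(i, j) coord f j e`_i.

Lemma change_mxE m (e f : m.-tuple V) i :
  basis_of {:V} f -> e`_i = \sum_j (coord f j e`_i) *: f`_j.
Proof. by move=> bf; apply: coord_basis bf _; rewrite memvf. Qed.

Lemma mul_change_mx m (e f h : m.-tuple V) :
  basis_of {:V} f -> change_mx e f *m change_mx f h = change_mx e h.
Proof.
move=> bf; apply/matrixP=> i k; rewrite !mxE.
rewrite [in RHS](change_mxE e i bf) linear_sum.
by apply: eq_bigr => j _; rewrite !mxE linearZ.
Qed.

Lemma change_mx_id m (e : m.-tuple V) :
  basis_of {:V} e -> change_mx e e = 1%:M.
Proof.
move=> be; apply/matrixP=> i k.
by rewrite !mxE coord_free ?(basis_free be).
Qed.

Lemma det_change_mx m (e f : m.-tuple V) : basis_of {:V} e -> basis_of {:V} f ->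
  \det (change_mx e f) * \det (change_mx f e) = 1.
Proof.
by move=> be bf; rewrite -det_mulmx mul_change_mx // change_mx_id // det1.
Qed.

Lemma basis_dim m (e : m.-tuple V) : basis_of {:V} e -> m = \dim {:V}.
Proof. by move=> be; rewrite -(size_basis be) ?size_tuple. Qed.

(** The matrix of g in the basis e is conjugate to the one in the reference
    basis by the change of basis matrix. *)
Lemma lfun_det_basis m (e : m.-tuple V) (g : 'End(V)) (M : 'M[F]_m) :
  basis_of {:V} e -> (forall i : 'I_m, g e`_i = \sum_j M i j *: e`_j) ->
  lfun_det g = \det M.
Proof.
move=> be; have em := basis_dim be; subst m => gM.
set v := vbasis {:V}; have bv : basis_of {:V} v by exact: vbasisP.
set G := passmx.mxof v v g.
have GE i j : G i j = coord v j (g v`_i).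
  by rewrite /G /passmx.mxof mxE /= passmx.vecof_delta -passmx.coord_rVof.
have PG : change_mx e v *m G = M *m change_mx e v.
  apply/matrixP=> i k; rewrite !mxE; transitivity (coord v k (g e`_i)).
    rewrite [in RHS](change_mxE e i bv) linear_sum linear_sum.
    by apply: eq_bigr => j _; rewrite mxE GE !linearZ.
  by rewrite gM linear_sum; apply: eq_bigr => j _; rewrite mxE linearZ.
have /(congr1 (fun x => x * \det (change_mx v e))) := congr1 determinant PG.
rewrite /= !det_mulmx -mulrA [\det G * _]mulrC mulrA.
by rewrite det_change_mx // mul1r -mulrA det_change_mx // mulr1.
Qed.
End Bases.

Lemma det_cast (R : comNzRingType) m n (e : m = n) (A : 'M[R]_m) :
  \det (castmx (e, e) A) = \det A.
Proof. by case: n / e; rewrite castmx_id. Qed.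

Lemma det_tens1 (R : comNzRingType) m n (A : 'M[R]_n) :
  \det ((1%:M : 'M[R]_m) *t A) = \det A ^+ m.
Proof.
elim: m => [|m IHm]; first by rewrite det_mx00.
rewrite -[m.+1]/(1 + m)%N scalar_mx_block tens_block_mx.
rewrite det_cast !tens0mx det_ublock IHm exprS; congr (_ * _).
by rewrite tens_scalar1mx det_cast.
Qed.

(** Here Z is the direct sum of m copies of W on which CZ acts diagonally: in a
    basis of Z made of m copies of a basis of W, the matrix of CZ is the
    Kronecker product of the identity with that of C. *)
Lemma lfun_det_copies (F : fieldType) (W Z : vectType F) m
    (psi : 'I_m -> 'Hom(W, Z)) (C : 'End(W)) (CZ : 'End(Z)) :
  \dim {:Z} = (m * \dim {:W})%N ->
  (forall z, exists w : 'I_m -> W, z = \sum_i psi i (w i)) ->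
  (forall i x, CZ (psi i x) = psi i (C x)) ->
  lfun_det CZ = lfun_det C ^+ m.
Proof.
move=> dZ spanZ CZE; set v := vbasis {:W}.
have bv : basis_of {:W} v by exact: vbasisP.
pose e := [tuple psi (mxtens_unindex k).1 v`_(mxtens_unindex k).2
          | k < (m * \dim {:W})%N].
have eE (k : 'I_(m * \dim {:W})) :
    e`_k = psi (mxtens_unindex k).1 v`_(mxtens_unindex k).2.
  by rewrite -tnth_nth tnth_mktuple.
have be : basis_of {:Z} e.
  rewrite basisEdim size_tuple dZ leqnn andbT; apply/subvP=> z _.
  have [w ->] := spanZ z; apply: memv_suml => i _.
  rewrite (coord_basis bv (memvf (w i))) linear_sum; apply: memv_suml => j _.
  rewrite linearZ memvZ // memv_span //=.
  have -> : psi i v`_j = e`_(mxtens_index (i, j)) by rewrite eE mxtens_indexK.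
  by rewrite mem_nth // size_tuple.
clearbody e; pose M : 'M[F]_(\dim {:W}) := \matrix_(i, j) coord v j (C v`_i).
rewrite (@lfun_det_basis _ _ _ v C M) ?(lfun_det_basis be (M := 1%:M *t M)) //.
- by rewrite det_tens1.
- move=> k; case: (mxtens_indexP k) => i j; rewrite eE mxtens_indexK /= CZE.
  rewrite {1}(coord_basis bv (memvf (C _))) linear_sum.
  rewrite (reindex (@mxtens_index m (\dim {:W}))) /=; last first.
    by exists (@mxtens_unindex _ _) => x _; rewrite ?mxtens_indexK ?mxtens_unindexK.
  rewrite (eq_bigr (fun x => ((i == x.1)%:R * M j x.2) *: psi x.1 v`_x.2)); last first.
    case=> a b _; rewrite tensmxE !mxE; congr (_ *: _).
    by rewrite -[LHS]/(e`_(mxtens_index (a, b))) eE mxtens_indexK.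
  rewrite -(pair_bigA _ (fun a b => ((i == a)%:R * M j b) *: psi a v`_b)) /=.
  rewrite (bigD1 i) //= [X in _ + X]big1 ?addr0 => [|a nai].
    by apply: eq_bigr => b _; rewrite eqxx mul1r mxE linearZ.
  by rewrite big1 // => b _; rewrite eq_sym (negPf nai) mul0r scale0r.
- move=> i; rewrite {1}(coord_basis bv (memvf (C _))).
  by apply: eq_bigr => j _; rewrite mxE.
Qed.

Lemma nth_cat_lshift (V : zmodType) m n (s : m.-tuple V) (t : n.-tuple V)
  (i : 'I_m) : (cat_tuple s t)`_(lshift n i) = s`_i.
Proof. by rewrite nth_cat size_tuple /= ltn_ord. Qed.

Lemma nth_cat_rshift (V : zmodType) m n (s : m.-tuple V) (t : n.-tuple V)
  (i : 'I_n) : (cat_tuple s t)`_(rshift m i) = t`_i.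
Proof. by rewrite nth_cat size_tuple /= ltnNge leq_addr addKn. Qed.

Section Gram.
Variables (F : fieldType) (V : vectType F) (b : {symmetric V}).

Definition cross_gram m n (s : m.-tuple V) (t : n.-tuple V) : 'M[F]_(m, n) :=
  \matrix_(i, j) b s`_i t`_j.

Lemma gram_cat m n (s : m.-tuple V) (t : n.-tuple V) :
  gram b (cat_tuple s t) =
  block_mx (gram b s) (cross_gram s t) (cross_gram t s) (gram b t).
Proof.
apply/matrixP=> i j; case: (split_ordP i) => i' ->; case: (split_ordP j) => j' ->;
  by rewrite ?(block_mxEul, block_mxEur, block_mxEdl, block_mxEdr) !mxE
             ?(nth_cat_lshift, nth_cat_rshift).
Qed.

Lemma symmC x y : b x y = b y x.
Proof. by rewrite hermC expr0 mul1r. Qed.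

Lemma gram_change m (e f : m.-tuple V) : basis_of {:V} f ->
  gram b e = change_mx e f *m gram b f *m (change_mx e f)^T.
Proof.
move=> bf; apply/matrixP=> i j; rewrite [LHS]mxE -mulmxA.
rewrite (change_mxE e i bf) linear_sumlz mxE; apply: eq_bigr => k _.
rewrite !mxE linearZl_LR; congr (_ * _).
rewrite (change_mxE e j bf) linear_sumr; apply: eq_bigr => l _.
by rewrite !mxE linearZr_LR /= mulrC.
Qed.

(** A change of basis of matrix M multiplies the Gram determinant by
    det M ^ 2. *)
Lemma gram_square_class m n (e : m.-tuple V) (f : n.-tuple V) :
  basis_of {:V} e -> basis_of {:V} f ->
  same_square_class (\det (gram b e)) (\det (gram b f)).
Proof.
move=> be bf; have em := basis_dim be; have en := basis_dim bf; subst n m.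
exists (\det (change_mx e f)).
  apply/eqP=> d0; have /eqP := det_change_mx be bf.
  by rewrite d0 mul0r eq_sym oner_eq0.
rewrite (gram_change e bf) !det_mulmx det_tr; ring.
Qed.

(** A linear relation between the e_i is a left null vector of their Gram
    matrix. *)
Lemma gram_det_free m (e : m.-tuple V) : \det (gram b e) != 0 -> free e.
Proof.
move=> nz; apply/freeP=> k k0 i.
have kG : (\row_j k j) *m gram b e = 0.
  apply/rowP=> j; rewrite !mxE -[RHS](linear0l b e`_j) -{1}k0 linear_sumlz.
  by apply: eq_bigr => l _; rewrite !mxE linearZl_LR.
have /(congr1 (mulmx^~ (invmx (gram b e)))) := kG.
rewrite mulmxK ?mul0mx; last by rewrite unitmxE unitfE.
by move/rowP/(_ i); rewrite !mxE.
Qed.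

Lemma gram_det_neq0 m (e : m.-tuple V) :
  nondegenerate b -> basis_of {:V} e -> \det (gram b e) != 0.
Proof.
move=> nd be; apply/det0P=> -[k k0 kG].
pose x := \sum_j k 0 j *: e`_j.
have : x \in orthov b fullv.
  apply/mem_orthovP=> y _; rewrite (coord_basis be (memvf y)) linear_sumr.
  apply: big1 => j _; rewrite linearZr_LR /= /x linear_sumlz.
  have := congr1 (fun A : 'rV_m => A 0 j) kG; rewrite !mxE => s0.
  rewrite (eq_bigr (fun l => k 0 l * gram b e l j)) ?s0 ?mulr0 //.
  by move=> l _; rewrite mxE linearZl_LR.
rewrite (eqP nd) memv0 => /eqP x0; case/eqP: k0; apply/rowP=> j.
by rewrite mxE; have /freeP := basis_free be; apply.
Qed.
End Gram.

(** The first three factors of the decomposition multiply to the Weyl element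
    (0 1; -1 0), of determinant 1, and the last one is triangular. *)
Lemma det_hyperbolic (F : fieldType) k (C : 'M[F]_k) :
  \det (block_mx 0 1%:M 1%:M C) = (-1) ^+ k.
Proof.
have e : block_mx 0 1%:M 1%:M C =
    block_mx 1%:M 1%:M 0 1%:M *m block_mx 1%:M 0 (- 1%:M) 1%:M
    *m block_mx 1%:M 1%:M 0 1%:M *m block_mx (- 1%:M) (- C) 0 (1%:M : 'M[F]_k).
  rewrite !mulmx_block !(mul1mx, mulmx1, mul0mx, mulmx0, addr0, add0r, mulNmx, mulmxN).
  by rewrite !(addrN, addNr, opprK, addr0, add0r, oppr0, mul0mx, mulNmx, mul1mx, mulmx1).
rewrite e !det_mulmx !det_ublock det_lblock !det1 !mul1r !mulr1.
by rewrite -scaleN1r detZ det1 mulr1.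
Qed.

(** * Perfect pairings and generators of the symplectic group *)

Section Invertible.
Variables (F : finFieldType) (V W : vectType F) (A : 'Hom(V, W)).

Lemma invertible_mapK : invertible_map A -> cancel A (A^-1)%VF.
Proof. by case=> /eqP k0 _ x; exact: lker0_lfunK. Qed.

Lemma invertible_mapVK : invertible_map A -> cancel (A^-1)%VF A.
Proof. by case=> _ im x; rewrite limg_lfunVK // im memvf. Qed.

Lemma can_invertible_map (B : W -> V) :
  cancel A B -> cancel B A -> invertible_map A.
Proof.
move=> AK BK; split; first by apply/eqP/lker0P/can_inj/AK.
by apply/vspaceP=> x; rewrite memvf -[x]BK memv_img ?memvf.
Qed.

Lemma inv_can (B : W -> V) : cancel A B -> cancel B A -> (A^-1)%VF =1 B.
Proof.
move=> AK BK x; have AVK := invertible_mapK (can_invertible_map AK BK).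
by rewrite -{1}[x]BK AVK.
Qed.
End Invertible.

Lemma inj_endo_invertible (F : finFieldType) (V : vectType F) (g : 'End(V)) :
  lker g = 0%VS -> invertible_map g.
Proof.
move=> k0; split=> //; apply/eqP; rewrite eqEdim subvf limg_dim_eq ?leqnn //.
by rewrite k0 capv0.
Qed.

Section PerfectPairing.
Variables (F : finFieldType) (Y Y' : vectType F) (pr : Y -> Y' -> F).

Definition bilinear_pairing : Prop :=
  (forall c x1 x2 y, pr (c *: x1 + x2) y = c * pr x1 y + pr x2 y) /\
  (forall c x y1 y2, pr x (c *: y1 + y2) = c * pr x y1 + pr x y2).

Hypothesis prP : bilinear_pairing.

Lemma prDl x1 x2 y : pr (x1 + x2) y = pr x1 y + pr x2 y.
Proof. by have := prP.1 1 x1 x2 y; rewrite scale1r mul1r. Qed.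
Lemma pr0l y : pr 0 y = 0.
Proof. by have /eqP := prDl 0 0 y; rewrite addr0 -subr_eq subrr eq_sym => /eqP. Qed.
Lemma prZl c x y : pr (c *: x) y = c * pr x y.
Proof. by have := prP.1 c x 0 y; rewrite pr0l !addr0. Qed.
Lemma prNl x y : pr (- x) y = - pr x y.
Proof. by rewrite -scaleN1r prZl mulN1r. Qed.
Lemma prDr x y1 y2 : pr x (y1 + y2) = pr x y1 + pr x y2.
Proof. by have := prP.2 1 x y1 y2; rewrite scale1r mul1r. Qed.
Lemma pr0r x : pr x 0 = 0.
Proof. by have /eqP := prDr x 0 0; rewrite addr0 -subr_eq subrr eq_sym => /eqP. Qed.
Lemma prZr c x y : pr x (c *: y) = c * pr x y.
Proof. by have := prP.2 c x y 0; rewrite pr0r !addr0. Qed.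
Lemma prNr x y : pr x (- y) = - pr x y.
Proof. by rewrite -scaleN1r prZr mulN1r. Qed.
Lemma pr_suml n (v : 'I_n -> Y) y : pr (\sum_i v i) y = \sum_i pr (v i) y.
Proof. by elim/big_rec2: _ => [|i a b _ <-]; rewrite ?pr0l ?prDl. Qed.
Lemma pr_sumr n x (v : 'I_n -> Y') : pr x (\sum_i v i) = \sum_i pr x (v i).
Proof. by elim/big_rec2: _ => [|i a b _ <-]; rewrite ?pr0r ?prDr. Qed.

(** This is perfectness of the pairing in a computable form: it separates points
    on both sides and every linear form is represented. *)
Definition dual_bases n (e : 'I_n -> Y) (e' : 'I_n -> Y') : Prop :=
  [/\ forall i j, pr (e i) (e' j) = (i == j)%:R,
      forall x, x = \sum_i pr x (e' i) *: e i
    & forall y, y = \sum_i pr (e i) y *: e' i].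

Variables (n : nat) (e : 'I_n -> Y) (e' : 'I_n -> Y').
Hypothesis ee : dual_bases e e'.

Notation sp := (symp_form pr).
Notation SpY := (Sp pr).

Lemma pr_sepl x : (forall y, pr x y = 0) -> x = 0.
Proof. by case: ee => _ h _ x0; rewrite [x]h big1 // => i _; rewrite x0 scale0r. Qed.
Lemma pr_sepr y : (forall x, pr x y = 0) -> y = 0.
Proof. by case: ee => _ _ h y0; rewrite [y]h big1 // => i _; rewrite y0 scale0r. Qed.

(** An endomorphism preserving a nondegenerate form is injective. *)
Lemma form_Sp (S : 'End((Y * Y')%type)) :
  (forall w w', sp (S w) (S w') = sp w w') -> SpY S.
Proof.
move=> h; split=> //; apply/eqP; rewrite -subv0; apply/subvP=> w.
rewrite memv_ker memv0 => /eqP Sw.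
have w0 w' : sp w w' = 0 by rewrite -h Sw /symp_form pr0l pr0r subr0.
have h1 : w.1 = 0.
  by apply: pr_sepl => f; have := w0 (0, f); rewrite /symp_form /= pr0l subr0.
have h2 : w.2 = 0.
  apply: pr_sepr => x; have := w0 (x, 0).
  by rewrite /symp_form /= pr0r sub0r => /eqP; rewrite oppr_eq0 => /eqP.
by rewrite [w]surjective_pairing h1 h2.
Qed.

Lemma Sp_comp (S S' : 'End((Y * Y')%type)) :
  SpY S -> SpY S' -> SpY (S \o S')%VF.
Proof. by move=> [_ h] [_ h']; apply: form_Sp => w w'; rewrite !comp_lfunE h h'. Qed.

Lemma Sp_N (A : 'Hom(Y', Y)) : sym_map pr A -> SpY (N_ A).
Proof.
move=> sA; apply: form_Sp => -[x f] [y g]; rewrite !N_E /symp_form /=.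
by rewrite !prDl sA; ring.
Qed.

Lemma Sp_D C Ct : contragredient pr C Ct -> SpY (D_ C Ct).
Proof.
by move=> h; apply: form_Sp => -[x f] [y g]; rewrite !D_E /symp_form /= !h.
Qed.

Lemma Sp_J (B : 'Hom(Y', Y)) :
  sym_map pr B -> invertible_map B -> SpY (J_ B).
Proof.
move=> sB iB; have BK := invertible_mapK iB; have VK := invertible_mapVK iB.
apply: form_Sp => -[x f] [y g]; rewrite !J_E /symp_form /= !prNr.
have sV u z : pr (B u) ((B^-1)%VF z) = pr z u by rewrite sB VK.
by rewrite !sV; ring.
Qed.

(** The standard dot product in a basis, as a map B = sum_i e_i (x) e_i. *)
Lemma dot_mapP : exists2 B : 'Hom(Y', Y), sym_map pr B & invertible_map B.
Proof.
have [dl hx hy] := ee.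
pose b y := \sum_i pr (e i) y *: e i; pose h x := \sum_i pr x (e' i) *: e' i.
pose B : 'Hom(Y', Y) := linfun b.
have BE y : B y = b y.
  rewrite linfunE // => c y1 y2; rewrite scaler_sumr -big_split /=.
  by apply: eq_bigr => i _; rewrite prP.2 scalerDl scalerA.
have bd x i : pr (e i) (h x) = pr x (e' i).
  rewrite pr_sumr (bigD1 i) //= prZr dl eqxx mulr1 big1 ?addr0 // => j nj.
  by rewrite prZr dl eq_sym (negPf nj) mulr0.
have hd y i : pr (b y) (e' i) = pr (e i) y.
  rewrite pr_suml (bigD1 i) //= prZl dl eqxx mulr1 big1 ?addr0 // => j nj.
  by rewrite prZl dl (negPf nj) mulr0.
exists B.
  move=> f g; rewrite !BE !pr_suml; apply: eq_bigr => i _.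
  by rewrite !prZl mulrC.
apply: (@can_invertible_map _ _ _ _ h) => [y|x]; rewrite BE.
  by rewrite [RHS]hy; apply: eq_bigr => i _; rewrite hd.
by rewrite [RHS]hx; apply: eq_bigr => i _; rewrite bd.
Qed.

Section Generation.
Variable Q : 'End((Y * Y')%type) -> Prop.
Hypotheses
  (QM : forall S S', SpY S -> SpY S' -> Q S -> Q S' -> Q (S \o S')%VF)
  (QN : forall A, sym_map pr A -> Q (N_ A))
  (QD : forall C Ct, invertible_map C -> contragredient pr C Ct -> Q (D_ C Ct))
  (QJ : forall B, sym_map pr B -> invertible_map B -> Q (J_ B)).

(** The lower unipotent group is conjugate to the upper one by J. *)
Lemma lower_unipotent (A : 'Hom(Y, Y')) :
    (forall x y, pr x (A y) = pr y (A x)) ->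
  exists2 L, SpY L /\ Q L & forall w, L w = (w.1, w.2 + A w.1).
Proof.
move=> sA; have [B sB iB] := dot_mapP.
have BK := invertible_mapK iB; have VK := invertible_mapVK iB.
have nB : cancel (- B)%R (fun x => - (B^-1)%VF x).
  by move=> f; rewrite opp_lfunE linearN opprK; apply: BK.
have nV : cancel (fun x => - (B^-1)%VF x) (- B)%R.
  by move=> f; rewrite opp_lfunE linearN opprK; apply: VK.
have snB : sym_map pr (- B) by move=> f g; rewrite !opp_lfunE !prNl sB.
have inB := can_invertible_map nB nV.
pose A1 : 'Hom(Y', Y) := (- (B \o A \o B))%VF.
have sA1 : sym_map pr A1.
  move=> f g; rewrite !opp_lfunE !prNl !comp_lfunE /=; congr (- _).
  by rewrite sB sA sB.
exists (J_ B \o (N_ A1 \o J_ (- B)))%VF.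
  have SN : SpY (N_ A1 \o J_ (- B))%VF by apply: Sp_comp; [apply: Sp_N | apply: Sp_J].
  split; first by apply: Sp_comp => //; apply: Sp_J.
  apply: QM => //; [exact: Sp_J | exact: QJ | apply: QM].
  - exact: Sp_N.
  - exact: Sp_J.
  - exact: QN.
  - exact: QJ.
case=> x f; rewrite !comp_lfunE J_E N_E J_E /= (inv_can nB nV) opprK VK.
congr pair; rewrite /A1 !opp_lfunE !comp_lfunE /= VK -opprD linearN opprK.
by rewrite -linearD /= BK.
Qed.

(** The blocks of S = (a b; c d) with respect to Y + Y'. *)
Section Blocks.
Variable S : 'End((Y * Y')%type).
Hypothesis SS : SpY S.

Definition blk_a : 'End(Y) := linfun (fun x => (S (x, 0)).1).
Definition blk_b : 'Hom(Y', Y) := linfun (fun f => (S (0, f)).1).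
Definition blk_c : 'Hom(Y, Y') := linfun (fun x => (S (x, 0)).2).
Definition blk_d : 'End(Y') := linfun (fun f => (S (0, f)).2).

Let linl k x y : S (k *: x + y, 0) = k *: S (x, 0) + S (y, 0).
Proof. by rewrite -linearP; congr (S _); congr pair; rewrite /= scaler0 addr0. Qed.
Let linr k f g : S (0, k *: f + g) = k *: S (0, f) + S (0, g).
Proof. by rewrite -linearP; congr (S _); congr pair; rewrite /= scaler0 addr0. Qed.

Lemma blkE x f : S (x, f) = (blk_a x + blk_b f, blk_c x + blk_d f).
Proof.
rewrite !linfunE => [|k u v|k u v|k u v|k u v]; rewrite ?linl ?linr //.
rewrite -[RHS]/((S (x, 0)) + S (0, f)) -linearD; congr (S _).
by congr pair; rewrite /= ?addr0 ?add0r.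
Qed.

Lemma blk_sp x f y g :
  pr (blk_a x + blk_b f) (blk_c y + blk_d g)
  - pr (blk_a y + blk_b g) (blk_c x + blk_d f) = pr x g - pr y f.
Proof. by have [_ /(_ (x, f) (y, g))] := SS; rewrite /symp_form !blkE. Qed.

Lemma blk_ac x y : pr (blk_a x) (blk_c y) = pr (blk_a y) (blk_c x).
Proof.
have := blk_sp x 0 y 0; rewrite !linear0 !addr0 !pr0r subrr => /eqP.
by rewrite subr_eq0 => /eqP.
Qed.

(** The matrix identity is S = N_(a c^-1) J_B D_C N_(c^-1 d), with C = - B c. *)
Lemma big_cell : invertible_map blk_c -> Q S.
Proof.
move=> ic; have cK := invertible_mapK ic; have cVK := invertible_mapVK ic.
have [B sB iB] := dot_mapP.
have BK := invertible_mapK iB; have VK := invertible_mapVK iB.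
have ac := blk_ac; have ad x g := blk_sp x 0 0 g; have bd f g := blk_sp 0 f 0 g.
have SE := blkE.
move: blk_a blk_b blk_c blk_d ac ad bd SE ic cK cVK => a b c d ac ad bd SE ic cK cVK.
set ci := (c^-1)%VF in cK cVK.
pose A1 : 'Hom(Y', Y) := (a \o ci)%VF.
have sA1 : sym_map pr A1.
  by move=> f g; rewrite !comp_lfunE -{1}[g]cVK ac cVK.
pose b1 : 'Hom(Y', Y) := (b - (A1 \o d))%VF.
have b1E f : b1 f = b f - A1 (d f) by rewrite add_lfunE opp_lfunE comp_lfunE.
have b1c g x : pr (b1 g) (c x) = - pr x g.
  have := ad x g; rewrite !linear0 !addr0 !add0r pr0l subr0 => <-.
  by rewrite b1E prDl prNl opprB; congr (_ - _); rewrite comp_lfunE ac cVK.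
have b1d f g : pr (b1 g) (d f) = pr (b1 f) (d g).
  have := bd f g; rewrite !linear0 !add0r !pr0l subrr => /eqP.
  by rewrite subr_eq0 !b1E !prDl !prNl sA1 => /eqP->.
pose A2 : 'Hom(Y', Y) := (ci \o d)%VF.
have sA2 : sym_map pr A2.
  by move=> f g; apply: oppr_inj; rewrite !comp_lfunE /= -!b1c !cVK b1d.
pose C : 'End(Y) := (- (B \o c))%VF; pose Ct : 'End(Y') := (B^-1 \o b1)%VF.
have CE x : C x = - B (c x) by rewrite opp_lfunE comp_lfunE.
have kC : contragredient pr C Ct.
  by move=> x f; rewrite CE comp_lfunE /= prNl sB VK b1c opprK.
have iC : invertible_map C.
  apply: (@can_invertible_map _ _ _ _ (fun y => - ci ((B^-1)%VF y))) => x.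
    by rewrite CE !linearN opprK /= BK cK.
  by rewrite CE !linearN opprK /= cVK VK.
have -> : S = (N_ A1 \o (J_ B \o (D_ C Ct \o N_ A2)))%VF.
  apply/lfunP=> -[x f]; rewrite !comp_lfunE N_E D_E J_E N_E SE /=.
  have -> : - (B^-1)%VF (C (x + A2 f)) = c x + d f.
    rewrite CE (linearN (B^-1)%VF) opprK /= BK (linearD c) /=; congr (_ + _).
    by rewrite /A2 comp_lfunE /= cVK.
  have -> : B (Ct f) = b1 f by rewrite /Ct comp_lfunE /= VK.
  have Ac : A1 (c x) = a x by rewrite /A1 comp_lfunE /= cK.
  by rewrite b1E (linearD A1) /= Ac addrCA subrK.
have SpN := Sp_N; have SpJ := Sp_J sB iB; have SpD := Sp_D kC.
have S1 := Sp_comp SpD (SpN _ sA2); have S2 := Sp_comp SpJ S1.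
by apply: QM => //; [exact: SpN | exact: QN | apply: QM => //; [exact: QJ |
   apply: QM => //; [exact: SpN | exact: QD | exact: QN]]].
Qed.
End Blocks.

Lemma inj_invertible (c : 'Hom(Y, Y')) :
  (forall x, c x = 0 -> x = 0) -> invertible_map c.
Proof.
move=> c0; have k0 : lker c = 0%VS.
  apply/eqP; rewrite -subv0; apply/subvP=> x; rewrite memv_ker memv0.
  by move/eqP/c0/eqP.
have [B _ [kB iB]] := dot_mapP.
split=> //; apply/eqP; rewrite eqEdim subvf /= limg_dim_eq ?k0 ?capv0 //.
by rewrite -[in X in (_ <= X)%N]iB limg_dim_eq ?kB ?capv0.
Qed.

(** On the image I of a the operator c a^-1 is a symmetric form, because S is
    symplectic; A corrects it to the dot product in a basis of I. A vector x
    killed by c + A a then has a x orthogonal to I for this dot product, whence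
    a x = 0 and so c x = 0. *)
Lemma shear_invertible S : SpY S -> exists2 A : 'Hom(Y, Y'),
  (forall x y, pr x (A y) = pr y (A x)) &
  forall x, blk_c S x + A (blk_a S x) = 0 -> x = 0.
Proof.
move=> SS; have ac := blk_ac SS; have [_ ex ey] := ee.
set a := blk_a S in ac *; set c := blk_c S in ac *.
set I := limg a; pose pi := projv I; pose bI := vbasis I.
pose k i u := coord bI i (pi u).
(* phi is the difference of the dot product on I and of the form c a^-1, both
   pulled back to Y by the projection pi onto I. *)
pose phi u v := \sum_i k i u * k i v - pr (pi v) (c ((a^-1)%VF (pi u))).
have kl i t u v : k i (t *: u + v) = t * k i u + k i v by rewrite /k !linearP.
have phil t u1 u2 v : phi (t *: u1 + u2) v = t * phi u1 v + phi u2 v.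
  rewrite /phi !linearP /= prP.2 mulrBr mulr_sumr opprD addrACA -big_split /=.
  by congr (_ + _); apply: eq_bigr => i _; rewrite kl; ring.
have phir t u v1 v2 : phi u (t *: v1 + v2) = t * phi u v1 + phi u v2.
  rewrite /phi !linearP /= prP.1 mulrBr mulr_sumr opprD addrACA -big_split /=.
  by congr (_ + _); apply: eq_bigr => i _; rewrite kl; ring.
pose Af u := \sum_j phi u (e j) *: e' j.
pose A : 'Hom(Y, Y') := linfun Af.
have AE u : A u = Af u.
  rewrite linfunE // => t u1 u2; rewrite /Af scaler_sumr -big_split /=.
  by apply: eq_bigr => j _; rewrite phil scalerDl scalerA.
have phi0 u : phi u 0 = 0.
  by rewrite /phi /k !linear0 pr0l subr0 big1 // => i _; rewrite linear0 mulr0.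
have phi_sum m (v : 'I_m -> Y) u : phi u (\sum_i v i) = \sum_i phi u (v i).
  elim/big_rec2: _ => [|i y z _ <-]; first exact: phi0.
  by rewrite -[v i]scale1r phir mul1r scale1r.
have phiZ t u v : phi u (t *: v) = t * phi u v.
  by rewrite -[t *: v]addr0 phir phi0 addr0.
have prA u v : pr v (A u) = phi u v.
  rewrite AE pr_sumr [in RHS](ex v) phi_sum; apply: eq_bigr => j _.
  by rewrite prZr phiZ mulrC.
have aV u : a ((a^-1)%VF (pi u)) = pi u by rewrite limg_lfunVK // memv_proj.
have aP x : pi (a x) = a x by rewrite projv_id // memv_img ?memvf.
have sA x y : pr x (A y) = pr y (A x).
  rewrite !prA /phi; congr (_ - _); first by apply: eq_bigr => i _; rewrite mulrC.
  by rewrite -{1}(aV x) ac aV.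
exists A => // x cx0.
have dot0 i : k i (a x) = 0.
  have [y ay] : exists y, a y = bI`_i.
    have : bI`_i \in I by rewrite vbasis_mem // mem_nth ?size_tuple.
    by case/memv_imgP=> y _ ->; exists y.
  have := congr1 (pr (a y)) cx0; rewrite prDr pr0r prA /phi.
  set x' := (a^-1)%VF _; have ax' : a x' = a x by rewrite /x' aV aP.
  rewrite aP ac -ax' [in X in _ - X]ac ax' -[pr _ (c y)]ac.
  rewrite ac addrCA subrr addr0 (bigD1 i) //= big1 => [|j nj].
    rewrite addr0 /k [pi (a y)]aP ay coord_free ?(basis_free (vbasisP _)) //.
    by rewrite eqxx mulr1.
  rewrite /k [pi (a y)]aP ay coord_free ?(basis_free (vbasisP _)) //.
  by rewrite eq_sym (negPf nj) mulr0.
have ax0 : a x = 0.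
  have aI : a x \in I by rewrite memv_img ?memvf.
  rewrite (coord_vbasis aI) big1 // => i _; have := dot0 i.
  by rewrite /k aP => ->; rewrite scale0r.
have c0 : c x = 0 by move: cx0; rewrite ax0 linear0 addr0.
have Sx : S (x, 0) = 0 by rewrite blkE !linear0 -/a -/c ax0 c0 !addr0.
have [kS _] := SS; have : (x, 0) \in lker S by rewrite memv_ker Sx.
by rewrite kS memv0 => /eqP[].
Qed.

(** A lower unipotent factor moves S into the big cell. *)
Theorem Sp_generated S : SpY S -> Q S.
Proof.
move=> SS; have [A sA cA] := shear_invertible SS.
have [L [SL QL] LE] := lower_unipotent sA.
have snA x y : pr x ((- A)%VF y) = pr y ((- A)%VF x).
  by rewrite !opp_lfunE !prNr sA.
have [L' [SL' QL'] LE'] := lower_unipotent snA.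
have -> : S = (L' \o (L \o S))%VF.
  by apply/lfunP=> w; rewrite !comp_lfunE LE' LE /= opp_lfunE addrK -surjective_pairing.
have SLS := Sp_comp SL SS; apply: QM => //.
apply: big_cell => //; apply: inj_invertible => x.
have -> : blk_c (L \o S)%VF x = blk_c S x + A (blk_a S x); last exact: cA.
have := blkE (L \o S)%VF x 0; rewrite comp_lfunE LE blkE !linear0 !addr0 /=.
by case.
Qed.
End Generation.
End PerfectPairing.

(** * The quadratic space on the quotient of N^perp by N *)

Lemma bilinear_form_pairing (F : finFieldType) (W : vectType F) (b : {symmetric W}) :
  bilinear_pairing b.
Proof.
split=> c x y z; first by rewrite linearPl.
by rewrite linearPr.
Qed.

Section Riesz.
Variables (F : finFieldType) (W : vectType F) (b : {symmetric W}).
Hypothesis nd : nondegenerate b.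

Lemma nondeg_sep x : (forall y, b x y = 0) -> x = 0.
Proof.
move=> x0; apply/eqP; rewrite -memv0 -(eqP nd).
by apply/mem_orthovP=> y _; apply: x0.
Qed.

Lemma isometry_OrthG (g : 'End(W)) : isometry b b g -> OrthG b g.
Proof.
move=> ig; split=> //; apply/eqP; rewrite -subv0; apply/subvP=> x.
rewrite memv_ker memv0 => /eqP gx; apply/eqP/nondeg_sep => y.
by rewrite -ig gx (pr0l (bilinear_form_pairing b)).
Qed.

(** By nondegeneracy w |-> (b w e_i)_i is an isomorphism onto row vectors;
    its inverse solves b (P v) = phi v. *)
Lemma adjoint_exists (V : vectType F) (phi : V -> W -> F) :
  bilinear_pairing phi -> exists P : 'Hom(V, W), forall v w, b (P v) w = phi v w.
Proof.
move=> [phil phir]; set d := \dim {:W}; set e := vbasis {:W}.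
pose R : 'Hom(W, 'rV[F]_d) := linfun (fun w => \row_(i < d) b w e`_i).
have RE w i : R w 0 i = b w e`_i.
  by rewrite linfunE ?mxE // => c x y; apply/rowP=> j; rewrite !mxE linearPl.
have pb := bilinear_form_pairing b.
have be w (x y : W) : (forall i : 'I_d, b x e`_i = b y e`_i) -> b x w = b y w.
  move=> h; rewrite [w]vbasis_sum !(pr_sumr pb); apply: eq_bigr => i _.
  by rewrite !(prZr pb) h.
have R0 w : R w = 0 -> w = 0.
  move=> Rw; apply: nondeg_sep => y; rewrite (be y w 0) ?(pr0l pb) // => i.
  by rewrite -RE Rw mxE (pr0l pb).
have kR : lker R = 0%VS.
  by apply/eqP; rewrite -subv0; apply/subvP=> w; rewrite memv_ker memv0 => /eqP/R0/eqP.
have iR : limg R = fullv.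
  apply/eqP; rewrite eqEdim subvf /= limg_dim_eq ?kR ?capv0 //.
  by rewrite dimvf /dim /= mul1n.
pose f v := \row_(i < d) phi v e`_i.
pose P : 'Hom(V, W) := (R^-1 \o linfun f)%VF.
exists P => v w.
have RP (i : 'I_d) : b (P v) e`_i = phi v e`_i.
  rewrite -RE comp_lfunE limg_lfunVK ?iR ?memvf // linfunE ?mxE // => c x y.
  by apply/rowP=> j; rewrite !mxE phil.
rewrite [w]vbasis_sum (pr_sumr pb) (pr_sumr (conj phil phir)).
by apply: eq_bigr => i _; rewrite (prZr pb) (prZr (conj phil phir)) RP.
Qed.

Lemma riesz (h : 'Hom(W, F^o)) : exists u, forall x, b u x = h x.
Proof.
have [|P PE] := @adjoint_exists F^o (fun c x => c * h x).
  split=> [c x1 x2 y|c x y1 y2]; first by rewrite mulrDl mulrA.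
  by rewrite linearP mulrDr mulrCA.
by exists (P 1) => x; rewrite PE mul1r.
Qed.

(** If x is not in N, a coordinate of x minus its projection to N is a linear
    form vanishing on N and not at x; the vector representing it is in the
    orthogonal of N. *)
Lemma orthov_orthov (N : {vspace W}) x :
  (forall y, y \in orthov b N -> b y x = 0) -> x \in N.
Proof.
move=> h; have [x0|xN] := eqVneq (x - projv N x) 0.
  by rewrite (subr0_eq x0) memv_proj.
case/negP: xN; apply/eqP; rewrite [LHS]vbasis_sum big1 // => i _.
pose g : 'Hom(W, F^o) :=
  linfun (fun z => coord (vbasis {:W}) i (z - projv N z) : F^o).
have gE z : g z = coord (vbasis {:W}) i (z - projv N z).
  rewrite linfunE // => c z1 z2; rewrite -[RHS]linearP; congr (coord _ _ _).
  by rewrite linearP scalerBr opprD addrACA.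
have [u uE] := riesz g; have := h u; rewrite uE gE => ->; rewrite ?scale0r //.
by apply/mem_orthovP=> n nN; rewrite uE gE projv_id // subrr linear0.
Qed.
End Riesz.

Section QuotientSymmetricForm.
Variables (F : finFieldType) (U : vectType F) (beta : {symmetric U}).
Variable N : {vspace U}.
Hypothesis N_iso : (N <= perp beta N)%VS.
Notation Np := (perp beta N).
Notation W := (perpq beta N).

Let bP := bilinear_form_pairing beta.

Lemma pi_perp_eq (x y : subvs_of Np) :
  (pi_perp x == pi_perp y) = (vsval x - vsval y \in N).
Proof.
rewrite /pi_perp piv_eq -memv_preim; congr (_ \in N).
by rewrite lfunE; apply: raddfB.
Qed.

Lemma pi_perp_reprv (a : W) : pi_perp (reprv a) = a.
Proof. exact: reprvK. Qed.

Lemma beta_NNp n x : n \in N -> x \in Np -> beta n x = 0.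
Proof. by move=> nN xN; rewrite symmC; apply: (mem_orthovP xN). Qed.

Lemma beta_pi (x y x' y' : subvs_of Np) :
    pi_perp x = pi_perp x' -> pi_perp y = pi_perp y' ->
  beta (vsval x) (vsval y) = beta (vsval x') (vsval y').
Proof.
move/eqP; rewrite pi_perp_eq => xN /eqP; rewrite pi_perp_eq => yN.
rewrite -[vsval x](subrK (vsval x')) -[vsval y](subrK (vsval y')).
move: (_ - _) xN (_ - _) yN => u uN v vN.
rewrite !(prDl bP) !(prDr bP) (beta_NNp uN (subvP N_iso _ vN)).
rewrite (beta_NNp uN (subvsP _)) [X in _ + (X + _)]symmC.
by rewrite (beta_NNp vN (subvsP _)) !add0r.
Qed.

Definition qform (a b : W) : F := beta (vsval (reprv a)) (vsval (reprv b)).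

Lemma qformE x y : qform (pi_perp x) (pi_perp y) = beta (vsval x) (vsval y).
Proof. by apply: beta_pi; rewrite pi_perp_reprv. Qed.

Lemma pi_perpP c x y : pi_perp (c *: x + y) = c *: pi_perp x + pi_perp y :> W.
Proof. exact: piv_is_linear. Qed.

Lemma qform_bilinear : bilinear_for
  (GRing.Scale.Law.clone _ _ ( *%R) _) (GRing.Scale.Law.clone _ _ ( *%R) _) qform.
Proof.
split=> [b c x y|b c x y].
  rewrite -[x]pi_perp_reprv -[y]pi_perp_reprv -[b]pi_perp_reprv -pi_perpP.
  by rewrite !qformE; apply: bP.1.
rewrite -[x]pi_perp_reprv -[y]pi_perp_reprv -[b]pi_perp_reprv -pi_perpP.
by rewrite !qformE; apply: bP.2.
Qed.

Lemma quotient_form_exists : exists beta' : {symmetric W},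
  forall x y : subvs_of Np, beta' (pi_perp x) (pi_perp y) = beta (vsval x) (vsval y).
Proof.
have sy a b : qform a b = (-1) ^+ false * idfun (qform b a).
  by rewrite expr0 mul1r /= /qform symmC.
pose m := bilinear_isBilinear.Build F W W F *%R *%R qform qform_bilinear.
pose h := isHermitianSesquilinear.Build F W false idfun qform sy.
pose beta' : {symmetric W} := HB.pack qform m h.
by exists beta' => x y; apply: qformE.
Qed.

Variable beta' : {symmetric W}.
Hypothesis beta'E : forall x y : subvs_of Np,
  beta' (pi_perp x) (pi_perp y) = beta (vsval x) (vsval y).
Hypothesis nd : nondegenerate beta.

Lemma pi_perp_N (x : subvs_of Np) : (pi_perp x == 0) = (vsval x \in N).
Proof.
have -> : (0 : W) = pi_perp 0 by rewrite /pi_perp linear0.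
by rewrite pi_perp_eq subr0.
Qed.

Lemma quotient_nondegenerate : nondegenerate beta'.
Proof.
apply/eqP/eqP; rewrite -subv0; apply/subvP=> a; rewrite memv0.
move/mem_orthovP=> a0; rewrite -[a]pi_perp_reprv pi_perp_N.
apply: (orthov_orthov nd) => y yNp; rewrite symmC.
have := a0 (pi_perp (vsproj Np y)) (memvf _).
by rewrite -{1}[a]pi_perp_reprv beta'E vsprojK.
Qed.

(** The adjoint P of the section s extends the projection N^perp -> W to all of
    U, which turns the projection into a linear map without subtypes. *)
Definition isometric_section (s : 'Hom(W, U)) (P : 'Hom(U, W)) : Prop :=
  [/\ forall a, s a \in Np,
      forall x : subvs_of Np, P (vsval x) = pi_perp x,
      forall a, P (s a) = a
    & forall u a, beta' (P u) a = beta u (s a)].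

Lemma isometric_section_exists : exists s P, isometric_section s P.
Proof.
pose e := vbasis {:W}; have b'P := bilinear_form_pairing beta'.
pose f a := \sum_(i < \dim {:W}) coord e i a *: vsval (reprv e`_i).
pose s : 'Hom(W, U) := linfun f.
have sE a : s a = f a.
  rewrite linfunE // => c x y; rewrite /f scaler_sumr -big_split /=.
  by apply: eq_bigr => i _; rewrite linearP scalerDl scalerA.
have sNp a : s a \in Np.
  by rewrite sE; apply: memv_suml => i _; rewrite memvZ // subvsP.
have spi a : pi_perp (vsproj Np (s a)) = a.
  have -> : vsproj Np (s a) = \sum_(i < \dim {:W}) coord e i a *: reprv e`_i.
    apply: val_inj; rewrite /= vsprojK // sE linear_sum.
    by apply: eq_bigr => i _; rewrite linearZ.
  rewrite [RHS]vbasis_sum; rewrite [LHS](linear_sum (piv _ : _ -> W)) /=.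
  by apply: eq_bigr => i _; rewrite linearZ /=; congr (_ *: _); apply: reprvK.
have [|P PE] := @adjoint_exists _ _ _ quotient_nondegenerate U (fun u a => beta u (s a)).
  by split=> [c x1 x2 y|c x y1 y2]; rewrite ?bP.1 // linearP bP.2.
have Ppi (x : subvs_of Np) : P (vsval x) = pi_perp x.
  apply/eqP; rewrite -subr_eq0; apply/eqP/(nondeg_sep quotient_nondegenerate) => a.
  rewrite (prDl b'P) (prNl b'P) PE -[in X in _ - X](spi a) beta'E vsprojK //.
  by rewrite subrr.
exists s, P; split=> // a.
by rewrite -{1}[s a](vsprojK (sNp a)) Ppi spi.
Qed.

Section WithSection.
Variables (s : 'Hom(W, U)) (P : 'Hom(U, W)).
Hypothesis sP : isometric_section s P.

Let b'P := bilinear_form_pairing beta'.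
Let sNp a : s a \in Np. Proof. by have [] := sP. Qed.
Let Ppi (x : subvs_of Np) : P (vsval x) = pi_perp x. Proof. by have [] := sP. Qed.
Let Ps a : P (s a) = a. Proof. by have [] := sP. Qed.
Let Padj u a : beta' (P u) a = beta u (s a). Proof. by have [] := sP. Qed.

Lemma section_perp a : s a \in Np. Proof. exact: sNp. Qed.
Lemma sectionK a : P (s a) = a. Proof. exact: Ps. Qed.

Lemma section_pi x : x \in Np -> P x = pi_perp (vsproj Np x).
Proof. by move=> xNp; rewrite -{1}[x](vsprojK xNp) Ppi. Qed.

Lemma section_N n : n \in N -> P n = 0.
Proof.
move=> nN; have nNp := subvP N_iso _ nN.
by rewrite section_pi //; apply/eqP; rewrite pi_perp_N vsprojK.
Qed.

Lemma section_eq x y : x - y \in N -> P x = P y.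
Proof. by move/section_N/eqP; rewrite linearB subr_eq0 => /eqP. Qed.

Lemma section_sub x : x \in Np -> x - s (P x) \in N.
Proof.
move=> xNp; have := pi_perp_eq (vsproj Np x) (vsproj Np (s (P x))).
by rewrite !vsprojK // -!section_pi // Ps eqxx.
Qed.

Lemma section_isometry a b : beta (s a) (s b) = beta' a b.
Proof. by rewrite -Padj Ps. Qed.

Lemma section_beta x y : x \in Np -> y \in Np -> beta' (P x) (P y) = beta x y.
Proof. by move=> xNp yNp; rewrite !section_pi // beta'E !vsprojK. Qed.

Section Stabiliser.
Variable g : 'End(U).
Hypothesis gN : OrthN beta N g.

Lemma OrthN_N n : n \in N -> g n \in N.
Proof. by move=> nN; case: gN => _ <-; apply: memv_img. Qed.

Lemma OrthN_perp x : x \in Np -> g x \in Np.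
Proof.
move=> /mem_orthovP xNp; apply/mem_orthovP=> n.
by case: gN => -[_ iso] <- /memv_imgP[m mN ->]; rewrite iso xNp.
Qed.

(** Any lift of a class may be used instead of the canonical representative,
    as g preserves N, on which P vanishes. *)
Lemma inducedE : induced beta N g = (P \o g \o s)%VF.
Proof.
have e a : pi_perp (vsproj Np (g (vsval (reprv a)))) = (P \o g \o s)%VF a.
  rewrite !comp_lfunE /= -section_pi ?OrthN_perp ?subvsP //.
  apply: section_eq; rewrite -linearB OrthN_N //.
  by rewrite -{2}[a]pi_perp_reprv -Ppi section_sub ?subvsP.
by apply/lfunP=> a; rewrite linfunE => [|c x y]; rewrite !e ?linearP.
Qed.

Lemma induced_P x : x \in Np -> induced beta N g (P x) = P (g x).
Proof.
move=> xNp; rewrite inducedE !comp_lfunE /=; apply/esym/section_eq.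
by rewrite -linearB OrthN_N // section_sub.
Qed.

Lemma induced_pi_perp (x : subvs_of Np) :
  induced beta N g (pi_perp x) = pi_perp (vsproj Np (g (vsval x))).
Proof. by rewrite -Ppi induced_P ?subvsP // section_pi ?OrthN_perp ?subvsP. Qed.

Lemma induced_OrthG : OrthG beta' (induced beta N g).
Proof.
apply: (isometry_OrthG quotient_nondegenerate) => a b.
rewrite inducedE !comp_lfunE /= section_beta ?OrthN_perp //.
by case: gN => -[_ ->] _; rewrite section_isometry.
Qed.
End Stabiliser.

Lemma induced_comp g h : OrthN beta N g -> OrthN beta N h ->
  OrthN beta N (g \o h)%VF /\
  induced beta N (g \o h)%VF = (induced beta N g \o induced beta N h)%VF.
Proof.
move=> gN hN; have ghN : OrthN beta N (g \o h)%VF.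
  case: gN hN => -[_ ig] gN [[_ ih] hN]; split; last by rewrite limg_comp hN gN.
  by apply: isometry_OrthG => // x y; rewrite !comp_lfunE ig ih.
split=> //; apply/lfunP=> a; rewrite !comp_lfunE -{1}[a]Ps induced_P ?sNp //.
rewrite !comp_lfunE -(induced_P gN) ?OrthN_perp //; congr (induced _ _ _ _).
by rewrite -{2}[a]Ps induced_P.
Qed.

Lemma OrthN_id : OrthN beta N \1%VF.
Proof.
split; last by rewrite lim1g.
by apply: isometry_OrthG => // x y; rewrite !id_lfunE.
Qed.

Lemma induced_id : induced beta N \1%VF = \1%VF.
Proof.
by apply/lfunP=> a; rewrite inducedE ?comp_lfunE ?id_lfunE ?Ps //; apply: OrthN_id.
Qed.

(** The isometry g' is transported to s(W) and extended by the identity on the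
    orthogonal of s(W), which contains N. *)
Lemma induced_surj g' : OrthG beta' g' ->
  exists2 g, OrthN beta N g & induced beta N g = g'.
Proof.
move=> [kg' ig']; pose g : 'End(U) := (s \o (g' - \1) \o P + \1)%VF.
have gE u : g u = s (g' (P u) - P u) + u.
  by rewrite add_lfunE !comp_lfunE add_lfunE opp_lfunE !id_lfunE.
have iso : isometry beta beta g.
  move=> u v; rewrite !gE !(prDl bP, prDr bP) section_isometry.
  rewrite [beta (s _) v]symmC -!Padj ?(prDl b'P, prDr b'P, prNl b'P, prNr b'P) ig'.
  rewrite ![beta' (P v) _](symmC beta') ![beta' (P u) (g' _)](symmC beta').
  by ring.
have gn n : n \in N -> g n = n.
  by move=> nN; rewrite gE section_N // linear0 subrr linear0 add0r.
have gN : OrthN beta N g.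
  split; first exact: isometry_OrthG.
  apply/vspaceP=> n; apply/memv_imgP/idP=> [[m mN ->]|nN]; first by rewrite gn.
  by exists n; rewrite ?gn.
exists g => //; rewrite inducedE //; apply/lfunP=> a.
by rewrite !comp_lfunE /= gE linearD /= !Ps subrK.
Qed.

(** Vectors f_j dual to the basis of N exist by nondegeneracy; removing their
    components s (P f_j) makes them orthogonal to s(W) and does not change
    their products with N. *)
Lemma hyperbolic_partners : exists f : (\dim N).-tuple U,
  (forall i j : 'I_(\dim N), beta (vbasis N)`_i f`_j = (i == j)%:R) /\
  (forall (j : 'I_(\dim N)) a, beta f`_j (s a) = 0).
Proof.
have ex (j : 'I_(\dim N)) : exists u, forall i : 'I_(\dim N),
    beta (vbasis N)`_i u = (i == j)%:R.
  pose h : 'Hom(U, F^o) := linfun (fun x => coord (vbasis N) j (projv N x) : F^o).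
  have hE x : h x = coord (vbasis N) j (projv N x).
    by rewrite linfunE // => c y z; rewrite !linearP.
  have [u uE] := riesz nd h; exists u => i.
  have nN : (vbasis N)`_i \in N by rewrite vbasis_mem // mem_nth ?size_tuple.
  by rewrite symmC uE hE projv_id // coord_free // (basis_free (vbasisP N)).
have [f0 f0E] := fin_all_exists ex.
exists [tuple f0 j - s (P (f0 j)) | j < \dim N]; split=> [i j|j a].
  rewrite nth_mktuple (prDr bP) (prNr bP) f0E beta_NNp ?sNp ?subr0 //.
  by rewrite vbasis_mem // mem_nth ?size_tuple.
rewrite nth_mktuple (prDl bP) (prNl bP) -!Padj Ps subrr //.
Qed.

Section AdaptedBasis.
Variable f : (\dim N).-tuple U.
Hypothesis f_N : forall i j : 'I_(\dim N), beta (vbasis N)`_i f`_j = (i == j)%:R.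
Hypothesis f_W : forall (j : 'I_(\dim N)) a, beta f`_j (s a) = 0.
Variables (d : nat) (e' : d.-tuple W).
Hypothesis be' : basis_of {:W} e'.
Notation n := (vbasis N).
Notation k := (\dim N).

Definition sW := [tuple s e'`_i | i < d].

Lemma sWE (i : 'I_d) : sW`_i = s e'`_i.
Proof. exact: nth_mktuple. Qed.

Lemma n_N (i : 'I_k) : n`_i \in N.
Proof. by rewrite vbasis_mem // mem_nth ?size_tuple. Qed.

Lemma P_f (i : 'I_k) : P f`_i = 0.
Proof.
by apply: (nondeg_sep quotient_nondegenerate) => a; rewrite Padj f_W.
Qed.

Definition part_f u : U := \sum_(i < k) beta n`_i u *: f`_i.
Definition part_n u : U := u - part_f u - s (P u).

Lemma part_nN u : part_n u \in N.
Proof.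
have Pf : P (part_f u) = 0.
  by rewrite linear_sum big1 // => i _; rewrite linearZ /= P_f scaler0.
have e : P u = P (u - part_f u) by rewrite linearB /= Pf subr0.
rewrite /part_n e.
apply: section_sub; apply/mem_orthovP=> m mN.
rewrite symmC (coord_vbasis mN) (pr_suml bP) big1 // => i _.
rewrite (prZl bP) (prDr bP) (prNr bP) (pr_sumr bP) (bigD1 i) //= big1.
  by rewrite (prZr bP) f_N eqxx mulr1 addr0 subrr mulr0.
by move=> j nj; rewrite (prZr bP) f_N eq_sym (negPf nj) mulr0.
Qed.

Lemma decompose u : u = \sum_(i < k) coord n i (part_n u) *: n`_i
  + \sum_(i < d) coord e' i (P u) *: sW`_i + \sum_(i < k) beta n`_i u *: f`_i.
Proof.
rewrite -(coord_vbasis (part_nN u)).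
have -> : \sum_(i < d) coord e' i (P u) *: sW`_i = s (P u).
  rewrite [in RHS](coord_basis be' (memvf (P u))) linear_sum.
  by apply: eq_bigr => i _; rewrite linearZ sWE.
by rewrite /part_n subrK subrK.
Qed.

Lemma nf_W (i : 'I_(k + k)) a : beta (cat_tuple n f)`_i (s a) = 0.
Proof.
case: (split_ordP i) => j ->; last by rewrite nth_cat_rshift.
by rewrite nth_cat_lshift beta_NNp ?n_N.
Qed.

Lemma gram_adapted : gram beta (cat_tuple (cat_tuple n f) sW)
  = block_mx (block_mx 0 1%:M 1%:M (gram beta f)) 0 0 (gram beta' e').
Proof.
rewrite !gram_cat; congr (block_mx (block_mx _ _ _ _) _ _ _).
- by apply/matrixP=> i j; rewrite !mxE beta_NNp ?n_N ?(subvP N_iso) ?n_N.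
- by apply/matrixP=> i j; rewrite !mxE f_N.
- by apply/matrixP=> i j; rewrite !mxE symmC f_N eq_sym.
- by apply/matrixP=> i j; rewrite !mxE sWE nf_W.
- by apply/matrixP=> j i; rewrite !mxE sWE symmC nf_W.
- by apply/matrixP=> i j; rewrite !mxE !sWE section_isometry.
Qed.

Lemma det_gram_adapted :
  \det (gram beta (cat_tuple (cat_tuple n f) sW))
  = (-1) ^+ k * \det (gram beta' e').
Proof. by rewrite gram_adapted det_ublock det_hyperbolic. Qed.

Lemma adapted_span (b : seq U) :
  {subset n <= b} -> {subset f <= b} -> {subset sW <= b} -> (fullv <= <<b>>)%VS.
Proof.
move=> nb fb sb; apply/subvP=> u _; rewrite [u]decompose.
have mem m (t : m.-tuple U) (i : 'I_m) : t`_i \in t by rewrite mem_nth ?size_tuple.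
by do 2?[apply: memvD]; apply: memv_suml => i _; rewrite memvZ // memv_span //;
   [apply: nb | apply: sb | apply: fb].
Qed.

(** The basis (n, f, s(e')) makes the Gram matrix block diagonal, whereas
    (n, s(e'), f) below is compatible with the flag N < N^perp < U. *)
Lemma adapted_basis : basis_of {:U} (cat_tuple (cat_tuple n f) sW).
Proof.
rewrite /basis_of eqEsubv subvf /=; apply/andP; split.
  by apply: adapted_span => x xb; rewrite !mem_cat xb ?orbT.
apply: (@gram_det_free _ _ beta _ (cat_tuple (cat_tuple n f) sW)).
rewrite det_gram_adapted mulf_neq0 ?signr_eq0 //.
exact: gram_det_neq0 quotient_nondegenerate be'.
Qed.

Lemma adapted_basis_flag : basis_of {:U} (cat_tuple (cat_tuple n sW) f).
Proof.
rewrite (@perm_basis _ _ _ (cat_tuple (cat_tuple n f) sW)); first exact: adapted_basis.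
by rewrite /= -!catA perm_cat2l perm_catC.
Qed.

(** In the basis adapted to the flag of N in N^perp in U, an element of the
    stabiliser of N is block triangular; its blocks on N and on U / N^perp
    are contragredient, hence have inverse determinants. *)
Lemma det_induced g : OrthN beta N g -> lfun_det g = lfun_det (induced beta N g).
Proof.
move=> gN; have [[_ ig] _] := gN.
pose A : 'M[F]_k := \matrix_(i, j) coord n j (g n`_i).
pose D : 'M[F]_k := \matrix_(i, j) beta n`_j (g f`_i).
pose G : 'M[F]_d := \matrix_(i, j) coord e' j (induced beta N g e'`_i).
pose Z : 'M[F]_(d, k) := \matrix_(i, j) coord n j (part_n (g sW`_i)).
pose X : 'M[F]_(k, k + d) :=
  row_mx (\matrix_(i, j) coord n j (part_n (g f`_i)))
         (\matrix_(i, j) coord e' j (P (g f`_i))).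
rewrite (lfun_det_basis (M := block_mx (block_mx A 0 Z G) 0 X D) adapted_basis_flag).
  rewrite (lfun_det_basis (M := G) be') => [|i]; last first.
    rewrite {1}(coord_basis be' (memvf (induced beta N g e'`_i))).
    by apply: eq_bigr => j _; rewrite mxE.
  rewrite !det_lblock mulrAC -[\det D]det_tr -det_mulmx.
  suff -> : A *m D^T = 1%:M by rewrite det1 mul1r.
  apply/matrixP=> i j; rewrite mxE [RHS]mxE -f_N -ig.
  rewrite [in RHS](coord_vbasis (OrthN_N gN (n_N i))) (pr_suml bP).
  by apply: eq_bigr => l _; rewrite !mxE (prZl bP).
move=> i; set M := block_mx _ _ _ _.
have -> : \sum_j M i j *: (cat_tuple (cat_tuple n sW) f)`_j =
    \sum_j M i (lshift k (lshift d j)) *: n`_j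
    + \sum_j M i (lshift k (rshift k j)) *: sW`_j
    + \sum_j M i (rshift (k + d) j) *: f`_j.
  rewrite !big_split_ord; congr (_ + _ + _); apply: eq_bigr => j _;
  by rewrite !(nth_cat_lshift, nth_cat_rshift).
have Np0 u (j : 'I_k) : u \in Np -> beta n`_j u = 0 by move=> uN; rewrite beta_NNp ?n_N.
rewrite [LHS]decompose /M.
case: (split_ordP i) => {}i ->.
  case: (split_ordP i) => {}i ->; rewrite !(nth_cat_lshift, nth_cat_rshift).
    have nN := OrthN_N gN (n_N i).
    have pn : part_n (g n`_i) = g n`_i.
      rewrite /part_n /part_f section_N // linear0 subr0 big1 ?subr0 // => j _.
      by rewrite Np0 ?scale0r // (subvP N_iso).
    congr (_ + _ + _); apply: eq_bigr => j _; congr (_ *: _).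
    - by rewrite !block_mxEul mxE pn.
    - by rewrite block_mxEul block_mxEur !mxE section_N // linear0.
    - by rewrite block_mxEur mxE Np0 // (subvP N_iso).
  have wN := OrthN_perp gN (sNp e'`_i); rewrite -sWE in wN.
  congr (_ + _ + _); apply: eq_bigr => j _; congr (_ *: _).
  - by rewrite block_mxEul block_mxEdl mxE.
  - by rewrite block_mxEul block_mxEdr !mxE inducedE // sWE !comp_lfunE.
  - by rewrite block_mxEur mxE Np0.
rewrite nth_cat_rshift; congr (_ + _ + _); apply: eq_bigr => j _; congr (_ *: _).
- by rewrite block_mxEdl row_mxEl mxE.
- by rewrite block_mxEdl row_mxEr mxE.
- by rewrite block_mxEdr mxE.
Qed.
End AdaptedBasis.

Lemma quotient_discriminant (e : (\dim {:U}).-tuple U) (e' : (\dim {:W}).-tuple W) :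
  basis_of {:U} e -> basis_of {:W} e' ->
  same_square_class (\det (gram beta' e')) ((-1) ^+ \dim N * \det (gram beta e)).
Proof.
move=> be be'; have [f [f_N f_W]] := hyperbolic_partners.
have := gram_square_class beta (adapted_basis f_N f_W be') be.
rewrite det_gram_adapted // => -[c c0 cE]; exists c => //.
by rewrite mulrCA -cE mulrA -expr2 sqrr_sign mul1r.
Qed.

Lemma quotient_dim : (\dim {:W} + 2 * \dim N)%N = \dim {:U}.
Proof.
have [f [f_N f_W]] := hyperbolic_partners.
have be' : basis_of {:W} (vbasis {:W}) by exact: vbasisP.
rewrite -(basis_dim (adapted_basis f_N f_W be')).
by rewrite addnC mul2n addnn.
Qed.

Lemma lfun_det_induced g : OrthN beta N g ->
  lfun_det g = lfun_det (induced beta N g).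
Proof.
have [f [f_N f_W]] := hyperbolic_partners; apply: det_induced f_N f_W _ _ (vbasisP _) _.
Qed.
End WithSection.
End QuotientSymmetricForm.

(** * Tensor products with a symplectic space *)

Lemma lfun_det_comp (F : fieldType) (V : vectType F) (g h : 'End(V)) :
  lfun_det (g \o h)%VF = lfun_det g * lfun_det h.
Proof. by rewrite /lfun_det (passmx.mxof_comp _ _ (vbasisP _)) det_mulmx mulrC. Qed.

Lemma lfun_det_id (F : fieldType) (V : vectType F) : lfun_det (\1 : 'End(V))%VF = 1.
Proof.
rewrite (lfun_det_basis (M := 1%:M) (vbasisP _)) ?det1 // => i.
rewrite id_lfunE (bigD1 i) //= mxE eqxx scale1r big1 ?addr0 // => j nj.
by rewrite mxE eq_sym (negPf nj) scale0r.
Qed.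

Lemma lfun_det_neq0 (F : finFieldType) (V : vectType F) (C : 'End(V)) :
  invertible_map C -> lfun_det C != 0.
Proof.
move=> [/eqP kC _]; have : lfun_det (C^-1)%VF * lfun_det C = 1.
  by rewrite -lfun_det_comp lker0_compVf // lfun_det_id.
by apply: contra_eq_neq => ->; rewrite mulr0 eq_sym oner_eq0.
Qed.

(** The tensor product of a quadratic space U with a symplectic space X + Xd,
    seen through its pure tensors tX u x and tXd u f. Keeping Xd and the
    carrier Y of the tensor product of U and X abstract reduces every
    computation below to one on pure tensors. *)
Section PureTensors.
Variables (F : finFieldType) (U X Xd Y : vectType F) (beta : {symmetric U}).
Notation Y' := 'Hom(X, U).
Variables (ev : X -> Xd -> F) (pr : Y -> Y' -> F).
Variables (tX : U -> X -> Y) (tXd : U -> Xd -> Y').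
Variable act : 'End(U) -> 'End((X * Xd)%type) -> 'End((Y * Y')%type).

Definition pure (u : U) (v : X * Xd) : Y * Y' := (tX u v.1, tXd u v.2).

Definition tensor_action : Prop :=
  [/\ bilinear_pairing pr /\
        (forall u x v f, pr (tX u x) (tXd v f) = beta u v * ev x f),
      forall w, exists m (u : 'I_m -> U) (v : 'I_m -> X * Xd),
        w = \sum_i pure (u i) (v i),
      [/\ forall u, linear (tX u), forall x, linear (tX^~ x)
        & \dim {:Y} = (\dim {:X} * \dim {:U})%N],
      forall u f x, tXd u f x = ev x f *: u
    & forall g S u v, act g S (pure u v) = pure (g u) (S v)].

Hypothesis tA : tensor_action.
Variables (n : nat) (e : 'I_n -> X) (e' : 'I_n -> Xd).
Hypotheses (evP : bilinear_pairing ev) (ee : dual_bases ev e e').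

Let prP : bilinear_pairing pr. Proof. by case: tA => -[]. Qed.
Let prE u x v f : pr (tX u x) (tXd v f) = beta u v * ev x f.
Proof. by case: tA => -[]. Qed.
Let spanE w : exists m (u : 'I_m -> U) (v : 'I_m -> X * Xd),
  w = \sum_i pure (u i) (v i).
Proof. by case: tA. Qed.
Let tXr u : linear (tX u). Proof. by case: tA => _ _ []. Qed.
Let tXl x : linear (tX^~ x). Proof. by case: tA => _ _ []. Qed.
Let tXdE u f x : tXd u f x = ev x f *: u. Proof. by case: tA. Qed.
Let actE g S u v : act g S (pure u v) = pure (g u) (S v).
Proof. by case: tA. Qed.

Lemma pure_ext (M M' : 'End((Y * Y')%type)) :
  (forall u v, M (pure u v) = M' (pure u v)) -> M = M'.
Proof.
move=> h; apply/lfunP=> w; have [m [u [v ->]]] := spanE w.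
by rewrite !linear_sum; apply: eq_bigr => i _; apply: h.
Qed.

Lemma act_comp g h S S' : act (g \o h)%VF (S \o S')%VF = (act g S \o act h S')%VF.
Proof. by apply: pure_ext => u v; rewrite comp_lfunE !actE !comp_lfunE. Qed.

Lemma act_id : act \1%VF \1%VF = \1%VF.
Proof. by apply: pure_ext => u v; rewrite actE !id_lfunE. Qed.

Lemma symp_pairing : bilinear_pairing (symp_form pr).
Proof.
have [pl prr] := prP.
by split=> c x y z; rewrite /symp_form /= pl prr; ring.
Qed.

Lemma symp_pure u v u' v' :
  symp_form pr (pure u v) (pure u' v') = beta u u' * symp_form ev v v'.
Proof.
by rewrite /symp_form /= !prE (symmC beta u' u) mulrBr.
Qed.

Lemma act_Sp g S : OrthG beta g -> Sp ev S -> Sp pr (act g S).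
Proof.
move=> [/eqP kg ig] [/eqP kS iS]; split.
  apply/eqP/lker0P/(can_inj (g := act (g^-1)%VF (S^-1)%VF)) => w.
  by rewrite -comp_lfunE -act_comp !lker0_compVf // act_id id_lfunE.
move=> w w'; have sP := symp_pairing.
have [m [u [v ->]]] := spanE w; have [m' [u' [v' ->]]] := spanE w'.
rewrite !linear_sum !(pr_suml sP); apply: eq_bigr => i _.
rewrite !(pr_sumr sP); apply: eq_bigr => j _.
by rewrite /= !actE !symp_pure ig iS.
Qed.

Lemma OrthG1 : OrthG beta \1%VF.
Proof.
split=> [|x y]; last by rewrite !id_lfunE.
by apply/eqP/lker0P=> x y; rewrite !id_lfunE.
Qed.

(** The tensor product is a sum of dim X copies of U, on which Lg is diagonal,
    and a sum of dim U copies of X, on which LC is. *)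
Lemma lfun_det_pure (g : 'End(U)) (C : 'End(X)) (Lg LC : 'End(Y)) :
  (forall u x, Lg (tX u x) = tX (g u) x) ->
  (forall u x, LC (tX u x) = tX u (C x)) ->
  lfun_det (Lg \o LC)%VF = lfun_det g ^+ \dim {:X} * lfun_det C ^+ \dim {:U}.
Proof.
move=> LgE LCE; have [_ _ [_ _ dY] _ _] := tA.
pose psi x : 'Hom(U, Y) := linfun (tX^~ x); pose phi u : 'Hom(X, Y) := linfun (tX u).
have psiE x u : psi x u = tX u x by rewrite (linfunE (tXl x)).
have phiE u x : phi u x = tX u x by rewrite (linfunE (tXr u)).
have spanY y : exists m (u : 'I_m -> U) (x : 'I_m -> X), y = \sum_i tX (u i) (x i).
  have [m [u [v yE]]] := spanE (y, 0); exists m, u, (fun i => (v i).1).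
  by rewrite -[y]/((y, 0 : Y').1) yE raddf_sum.
rewrite lfun_det_comp; congr (_ * _).
  apply: (@lfun_det_copies _ _ _ _ (fun i => psi (vbasis {:X})`_i)) => // [y|i u].
    have [m [u [x ->]]] := spanY y.
    exists (fun i => \sum_j coord (vbasis {:X}) i (x j) *: u j).
    under [RHS]eq_bigr do rewrite linear_sum /=.
    rewrite exchange_big /=; apply: eq_bigr => j _.
    rewrite -phiE {1}[x j]vbasis_sum linear_sum; apply: eq_bigr => i _.
    by rewrite !linearZ /= phiE psiE.
  by rewrite !psiE LgE.
apply: (@lfun_det_copies _ _ _ _ (fun j => phi (vbasis {:U})`_j)) => // [|y|j x].
- by rewrite dY mulnC.
- have [m [u [x ->]]] := spanY y.
  exists (fun i => \sum_j coord (vbasis {:U}) i (u j) *: x j).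
  under [RHS]eq_bigr do rewrite linear_sum /=.
  rewrite exchange_big /=; apply: eq_bigr => j _.
  rewrite -psiE {1}[u j]vbasis_sum linear_sum; apply: eq_bigr => i _.
  by rewrite !linearZ /= phiE psiE.
- by rewrite !phiE LCE.
Qed.

Lemma tXd_sum (b : Y') : b = \sum_i tXd (b (e i)) (e' i).
Proof.
have [_ ex _] := ee; apply/lfunP=> x; rewrite sum_lfunE {1}[x]ex linear_sum.
by apply: eq_bigr => i _; rewrite linearZ tXdE.
Qed.

Lemma pr_tX u x b : pr (tX u x) b = beta u (b x).
Proof.
have [_ ex _] := ee; have bP := bilinear_form_pairing beta.
rewrite {1}[b]tXd_sum (pr_sumr prP) {2}[x]ex linear_sum (pr_sumr bP).
by apply: eq_bigr => i _; rewrite prE linearZ (prZr bP) mulrC.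
Qed.

Lemma snd_ext (V : vectType F) (M M' : 'Hom(Y', V)) :
  (forall u f, M (tXd u f) = M' (tXd u f)) -> M = M'.
Proof.
move=> h; apply/lfunP=> b; rewrite [b]tXd_sum !linear_sum.
by apply: eq_bigr => i _; apply: h.
Qed.

Lemma fst_ext (V : vectType F) (M M' : 'Hom(Y, V)) :
  (forall u x, M (tX u x) = M' (tX u x)) -> M = M'.
Proof.
move=> h; apply/lfunP=> y; have [m [u [v yE]]] := spanE (y, 0).
have -> : y = \sum_i tX (u i) (v i).1 by rewrite -[y]/((y, 0 : Y').1) yE raddf_sum.
by rewrite !linear_sum; apply: eq_bigr => i _; apply: h.
Qed.

Lemma tX0 u : tX u 0 = 0.
Proof. by rewrite -(linfunE (tXr u)) linear0. Qed.
Lemma tXd0 u : tXd u 0 = 0.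
Proof. by apply/lfunP=> x; rewrite tXdE (pr0r evP) scale0r zero_lfunE. Qed.
Lemma tXdN u f : tXd u (- f) = - tXd u f.
Proof. by apply/lfunP=> x; rewrite opp_lfunE !tXdE (prNr evP) scaleNr. Qed.

Lemma act_tX g S u x : act g S (tX u x, 0) = pure (g u) (S (x, 0)).
Proof. by rewrite -actE /pure tXd0. Qed.
Lemma act_tXd g S u f : act g S (0, tXd u f) = pure (g u) (S (0, f)).
Proof. by rewrite -actE /pure tX0. Qed.

(** The shear At of the tensor product which corresponds to a shear A of X + Xd
    is the upper right block of the operator by which N_A acts. *)
Lemma act_shear (A : 'Hom(Xd, X)) : exists At : 'Hom(Y', Y),
  (forall u f, At (tXd u f) = tX u (A f)) /\
  (forall b b', pr (At b) b' = \sum_i beta (b (e i)) (b' (A (e' i)))).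
Proof.
pose At := blk_b (act \1%VF (N_ A)); exists At.
have AtE u f : At (tXd u f) = tX u (A f).
  by have := blkE (act \1%VF (N_ A)) 0 (tXd u f);
    rewrite act_tXd N_E /pure !linear0 !add0r id_lfunE => -[].
split=> // b b'; rewrite {1}[b]tXd_sum linear_sum (pr_suml prP).
by apply: eq_bigr => i _; rewrite /= AtE pr_tX.
Qed.

Lemma act_N (A : 'Hom(Xd, X)) (At : 'Hom(Y', Y)) :
  (forall u f, At (tXd u f) = tX u (A f)) ->
  act \1%VF (N_ A) = N_ At.
Proof.
move=> AtE; apply: pure_ext => u [x f]; rewrite actE !N_E AtE id_lfunE.
rewrite /pure /=; congr (_, _); rewrite -(linfunE (tXr u)) linearD.
by rewrite /= !(linfunE (tXr u)).
Qed.

(** A shear is symplectic exactly when its block is symmetric. *)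
Lemma act_N_sym (A : 'Hom(Xd, X)) (At : 'Hom(Y', Y)) :
  (forall u f, At (tXd u f) = tX u (A f)) ->
  sym_map ev A -> sym_map pr At.
Proof.
move=> AtE sA y y'; have := act_Sp OrthG1 (Sp_N evP ee sA).
rewrite (act_N AtE) => -[_ sp]; have := sp (0, y) (0, y').
rewrite /symp_form !N_E /= !add0r !(pr0l prP) subrr => /eqP.
by rewrite subr_eq0 => /eqP.
Qed.

(** The inverse of Bt is read off from the lower left block of the operator by
    which J_B acts. *)
Lemma act_J (B : 'Hom(Xd, X)) (Bt : 'Hom(Y', Y)) :
  invertible_map B -> (forall u f, Bt (tXd u f) = tX u (B f)) ->
  invertible_map Bt /\ act \1%VF (J_ B) = J_ Bt.
Proof.
move=> iB BtE; have BK := invertible_mapK iB; have VK := invertible_mapVK iB.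
pose Bi := (- blk_c (act \1%VF (J_ B)))%R.
have BiE u x : Bi (tX u x) = tXd u ((B^-1)%VF x).
  have := blkE (act \1%VF (J_ B)) (tX u x) 0.
  rewrite act_tX J_E /pure !linear0 !addr0 id_lfunE tXdN => -[_ cE].
  by rewrite opp_lfunE -cE opprK.
have K1 : cancel Bt Bi.
  move=> y; rewrite -comp_lfunE -[RHS]id_lfunE; congr (fun_of_lfun _ _).
  by apply: snd_ext => u f; rewrite comp_lfunE BtE BiE BK id_lfunE.
have K2 : cancel Bi Bt.
  move=> y; rewrite -comp_lfunE -[RHS]id_lfunE; congr (fun_of_lfun _ _).
  by apply: fst_ext => u x; rewrite comp_lfunE BiE BtE VK id_lfunE.
split; first exact: can_invertible_map K1 K2.
apply: pure_ext => u [x f]; rewrite actE !J_E id_lfunE /= BtE (inv_can K1 K2) BiE.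
by rewrite /pure /= tXdN.
Qed.

(** On Y = U (x) X the operator is g (x) C, and on Hom(X, U) it is
    b |-> g o b o C^-1. *)
Lemma act_D g C Ct : OrthG beta g -> invertible_map C -> contragredient ev C Ct ->
  exists (L : 'End(Y)) (Rt : 'End(Y')),
  [/\ invertible_map L, contragredient pr L Rt, act g (D_ C Ct) = D_ L Rt,
      lfun_det L = lfun_det g ^+ \dim {:X} * lfun_det C ^+ \dim {:U}
    & forall b x, Rt b (C x) = g (b x)].
Proof.
move=> og iC kC; have SD := Sp_D evP ee kC.
pose LL h K Kt := blk_a (act h (D_ K Kt)).
have LLE h K Kt u x : LL h K Kt (tX u x) = tX (h u) (K x).
  have := blkE (act h (D_ K Kt)) (tX u x) 0.
  by rewrite act_tX D_E /pure !linear0 !addr0 => -[].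
pose L := LL g C Ct; pose Rt := blk_d (act g (D_ C Ct)).
have LE u x : L (tX u x) = tX (g u) (C x) by apply: LLE.
have RE u f : Rt (tXd u f) = tXd (g u) (Ct f).
  have := blkE (act g (D_ C Ct)) 0 (tXd u f).
  by rewrite act_tXd D_E /pure !linear0 !add0r => -[].
have aD : act g (D_ C Ct) = D_ L Rt.
  by apply: pure_ext => u [x f]; rewrite actE !D_E LE RE.
exists L, Rt; have := act_Sp og SD; rewrite aD => -[kD sp]; split=> //.
- have kL : lker L = 0%VS.
    have Dinj : injective (D_ L Rt) by apply/lker0P/eqP.
    apply/eqP; rewrite -subv0; apply/subvP=> y; rewrite memv_ker memv0 => /eqP Ly.
    by have := Dinj (y, 0) (0, 0); rewrite !D_E /= Ly !linear0 => /(_ erefl) [->].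
  exact: inj_endo_invertible.
- move=> y y'; have := sp (y, 0) (0, y').
  by rewrite /symp_form !D_E /= !linear0 !(pr0l prP) !subr0.
- have -> : L = (LL g \1 \1 \o LL \1 C Ct)%VF.
    by apply: fst_ext => u x; rewrite comp_lfunE !LLE !id_lfunE.
  by apply: lfun_det_pure => u x; rewrite LLE ?id_lfunE.
- move=> b x; rewrite {1}[b]tXd_sum linear_sum sum_lfunE.
  have [_ ex _] := ee; rewrite [in RHS](ex x) !linear_sum.
  by apply: eq_bigr => i _; rewrite /= RE tXdE kC !linearZ.
Qed.
End PureTensors.

Section Evaluation.
Variables (F : finFieldType) (X : vectType F).

Lemma evp_pairing : bilinear_pairing (evp X).
Proof.
split=> c x y z; rewrite /evp; first by rewrite linearP.
by rewrite add_lfunE scale_lfunE.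
Qed.

Lemma evp_dual_bases :
  dual_bases (evp X) (fun i : 'I_(\dim {:X}) => (vbasis {:X})`_i) (@dual_vbasis F X).
Proof.
split=> [i j|x|y].
- by rewrite /evp dual_vbasisE coord_free ?(basis_free (vbasisP _)) // eq_sym.
- rewrite {1}[x]vbasis_sum; apply: eq_bigr => i _.
  by rewrite /evp dual_vbasisE.
- exact: dual_vbasis_sum.
Qed.
End Evaluation.

Section HomTensor.
Variables (F : finFieldType) (U X : vectType F) (beta : {symmetric U}).
Notation UX := 'Hom(dual X, U).
Notation UXd := 'Hom(X, U).
Notation e := (vbasis {:X}).
Notation pr := (tens_pair X beta).

Lemma tens_pairing : bilinear_pairing pr.
Proof.
split=> c x y z; rewrite /tens_pair mulr_sumr -big_split /=;
  apply: eq_bigr => i _; rewrite add_lfunE scale_lfunE.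
  by rewrite linearPl.
by rewrite linearPr.
Qed.

Lemma tensX_sum (a : UX) : a = \sum_(i < \dim {:X}) tensX (a (dual_vbasis i)) e`_i.
Proof.
apply/lfunP=> f; rewrite {1}[f]dual_vbasis_sum linear_sum sum_lfunE.
by apply: eq_bigr => i _; rewrite linearZ tensXE.
Qed.

Lemma tensXd_sum (b : UXd) : b = \sum_(i < \dim {:X}) tensXd (b e`_i) (dual_vbasis i).
Proof.
apply/lfunP=> x; rewrite {1}[x]vbasis_sum linear_sum sum_lfunE.
by apply: eq_bigr => i _; rewrite linearZ tensXdE dual_vbasisE.
Qed.

Lemma tensV_span (w : UX * UXd) : exists m (u : 'I_m -> U) (v : 'I_m -> X * dual X),
  w = \sum_i tensV (u i) (v i).
Proof.
pose n := \dim {:X}.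
exists (n + n)%N.
exists (fun j => match split j with inl i => w.1 (dual_vbasis i) | inr i => w.2 e`_i end).
exists (fun j => match split j with inl i => (e`_i, 0) | inr i => (0, dual_vbasis i) end).
rewrite big_split_ord /=.
have sumE m (E : 'I_m -> UX * UXd) : \sum_i E i = (\sum_i (E i).1, \sum_i (E i).2).
  by rewrite [LHS]surjective_pairing (raddf_sum fst) (raddf_sum snd).
rewrite !sumE.
have t0 u : tensX u 0 = 0 :> UX.
  by apply/lfunP=> f; rewrite tensXE linear0 scale0r zero_lfunE.
have td0 u : tensXd u 0 = 0 :> UXd.
  by apply/lfunP=> x; rewrite tensXdE !zero_lfunE scale0r.
rewrite [w]surjective_pairing -[RHS]/(_, _) /=; congr (_, _).
  rewrite [X in _ + X]big1 ?addr0 => [|i _].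
    rewrite {1}[w.1]tensX_sum; apply: eq_bigr => i _.
    by rewrite (unsplitK (inl i)).
  by rewrite (unsplitK (inr i)) t0.
rewrite [X in X + _]big1 ?add0r => [|i _].
  rewrite {1}[w.2]tensXd_sum; apply: eq_bigr => i _.
  by rewrite (unsplitK (inr i)).
by rewrite (unsplitK (inl i)) td0.
Qed.

Lemma dim_hom (V V' : vectType F) : \dim {:'Hom(V, V')} = (\dim {:V} * \dim {:V'})%N.
Proof. by rewrite !dimvf. Qed.

Lemma tens_act_tensor_action :
  tensor_action beta (evp X) pr (@tensX F U X) (@tensXd F U X) (@tens_act F U X).
Proof.
split; [split | | split | |].
- exact: tens_pairing.
- exact: tens_pairE.
- exact: tensV_span.
- exact: tensX_linear.
- exact: tensX_linearl.
- by rewrite !dim_hom !dimvf /dim /= muln1.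
- exact: tensXdE.
- exact: tens_actE.
Qed.
End HomTensor.

(** * The code space and the intertwining operator *)

Section Functions.
Variables (R : realType) (F : finFieldType) (Z : vectType F).
Notation fZ := (finvect_type Z).

Lemma L2_expand (Phi : L2 R Z) : Phi = \sum_(z : fZ) Phi z *: delta R z.
Proof.
have E (z y : fZ) : (Phi z *: delta R z) y = Phi z * (y == z)%:R by rewrite !ffunE.
apply/ffunP=> y; transitivity (\sum_(z : fZ) Phi z * (y == z)%:R); last first.
  by rewrite sum_ffunE; apply: eq_bigr => z _; rewrite E.
rewrite (bigD1 y) //= eqxx mulr1 big1 ?addr0 // => z nz.
by rewrite eq_sym (negPf nz) mulr0.
Qed.

Lemma L2_apply (M : 'End(L2 R Z)) (Phi : L2 R Z) (z : fZ) :
  M Phi z = \sum_(y : fZ) Phi y * M (delta R y) z.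
Proof.
rewrite {1}[Phi]L2_expand linear_sum sum_ffunE; apply: eq_bigr => y _.
by rewrite linearZ ffunE.
Qed.

Lemma L2_diag (M : 'End(L2 R Z)) (c : Z -> R[i]) (Phi : L2 R Z) (z : fZ) :
  (forall y, M (delta R y) = c y *: delta R y) -> M Phi z = c z * Phi z.
Proof.
move=> ME; rewrite L2_apply (bigD1 z) //= big1 => [|y nyz].
  by rewrite ME !ffunE eqxx addr0 [c z *: _]mulr1 mulrC.
by rewrite ME !ffunE eq_sym (negPf nyz) [c y *: _]mulr0 mulr0.
Qed.

Lemma L2_perm (M : 'End(L2 R Z)) (c : R[i]) (k : Z -> Z) (Phi : L2 R Z) (z : fZ) :
  injective k -> (forall y, M (delta R y) = c *: delta R (k y)) ->
  M Phi (k z) = c * Phi z.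
Proof.
move=> ik ME; rewrite L2_apply (bigD1 z) //= big1 => [|y nyz].
  by rewrite ME !ffunE eqxx addr0 [c *: _]mulr1 mulrC.
by rewrite ME !ffunE (inj_eq ik) eq_sym (negPf nyz) [c *: _]mulr0 mulr0.
Qed.

Lemma L2_kernel (M : 'End(L2 R Z)) (c : R[i]) (k : Z -> Z -> R[i])
    (Phi : L2 R Z) (z : fZ) :
  (forall y, M (delta R y) = c *: \sum_(y' : fZ) k y y' *: delta R y') ->
  M Phi z = c * \sum_(y : fZ) k y z * Phi y.
Proof.
move=> ME; rewrite L2_apply mulr_sumr; apply: eq_bigr => y _.
rewrite ME ffunE sum_ffunE (bigD1 z) //= big1 => [|y' ny].
  by rewrite !ffunE eqxx addr0 [k y z *: _]mulr1 mulrC [c *: _]/(c * _) mulrA.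
by rewrite !ffunE eq_sym (negPf ny) [_ *: _]mulr0.
Qed.
End Functions.

Lemma limg_subP (F : fieldType) (V V' : vectType F) (b : 'Hom(V, V')) (K : {vspace V'}) :
  reflect (forall x, b x \in K) (limg b <= K)%VS.
Proof.
apply: (iffP subvP) => [h x|h _ /memv_imgP[x _ ->] //].
by apply: h; rewrite memv_img ?memvf.
Qed.

(** The quotient of N^perp by N enters only through the maps s and P, so it is
    replaced by an arbitrary quadratic space W, and the dual of X by an
    arbitrary space Xd in perfect pairing with X. *)
Section Reduction.
Variables (R : realType) (F : finFieldType) (p : nat) (pF : p \in [pchar F]).
Hypothesis p_odd : odd p.
Variables (X Xd : vectType F) (ev : X -> Xd -> F).
Variables (n : nat) (e : 'I_n -> X) (e' : 'I_n -> Xd).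
Hypotheses (evP : bilinear_pairing ev) (ee : dual_bases ev e e').

Variables (U W : vectType F) (beta : {symmetric U}) (beta' : {symmetric W}).
Variables (N : {vspace U}) (s : 'Hom(W, U)) (P : 'Hom(U, W)).
Notation Np := (perp beta N).
Hypotheses (N_iso : (N <= Np)%VS) (sNp : forall a, s a \in Np)
  (sK : cancel s P) (PN : forall x, x \in N -> P x = 0)
  (sP : forall x, x \in Np -> x - s (P x) \in N)
  (Pbeta : forall x y, x \in Np -> y \in Np -> beta' (P x) (P y) = beta x y).

Notation Y' := 'Hom(X, U).
Notation Z' := 'Hom(X, W).
Notation fY := (finvect_type Y').
Notation fZ := (finvect_type Z').
Notation w := (omega R pF).

Definition lift_hom (z : Z') : Y' := (s \o z)%VF.
Definition proj_hom (b : Y') : Z' := (P \o b)%VF.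

Lemma liftE z x : lift_hom z x = s (z x). Proof. exact: comp_lfunE. Qed.
Lemma projE b x : proj_hom b x = P (b x). Proof. exact: comp_lfunE. Qed.

Lemma lift_perp z : (limg (lift_hom z) <= Np)%VS.
Proof. by apply/limg_subP=> x; rewrite liftE. Qed.

Lemma liftK z : proj_hom (lift_hom z) = z.
Proof. by apply/lfunP=> x; rewrite projE liftE sK. Qed.

Lemma lift_proj b : (limg b <= Np)%VS -> (limg (b - lift_hom (proj_hom b)) <= N)%VS.
Proof.
move/limg_subP=> bNp; apply/limg_subP=> x.
by rewrite add_lfunE opp_lfunE liftE projE sP.
Qed.

Lemma proj_hom_congr b b' : (limg (b - b')%R <= N)%VS -> proj_hom b = proj_hom b'.
Proof.
move/limg_subP=> bN; apply/lfunP=> x; rewrite !projE; apply/subr0_eq.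
by rewrite -linearB /= PN //; have := bN x; rewrite add_lfunE opp_lfunE.
Qed.

Lemma perp_congr (b b' : Y') : (limg (b - b')%R <= N)%VS ->
  (limg b <= Np)%VS = (limg b' <= Np)%VS.
Proof.
move=> bN; have bN' := subv_trans bN N_iso.
apply/limg_subP/limg_subP=> h x; have := limg_subP _ _ bN' x;
  rewrite add_lfunE opp_lfunE => d.
  by rewrite -[b' x](subKr (b x)) rpredB.
by rewrite -[b x](subrK (b' x)) rpredD.
Qed.

Lemma CSSP (Phi : L2 R Y') : reflect
  ((forall b : fY, Phi b != 0 -> (limg (b : Y') <= Np)%VS) /\
   (forall b b' : fY, (limg ((b : Y') - b')%R <= N)%VS -> Phi b = Phi b'))
  (Phi \in CSS beta N R X).
Proof.
rewrite inE; apply: (iffP andP) => -[h1 h2]; split.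
- by move=> b; apply/implyP; move/forallP: h1; apply.
- by move=> b b' bN; apply/eqP; move/forallP: h2 => /(_ b)/forallP/(_ b')/implyP; apply.
- by apply/forallP=> b; apply/implyP; apply: h1.
- by apply/forallP=> b; apply/forallP=> b'; apply/implyP=> bN; rewrite (h2 b b').
Qed.

(** Restriction of functions to the maps s o z, the equivalence between the
    code and the functions on Hom(X, W). *)
Definition restr : 'Hom(L2 R Y', L2 R Z') :=
  linfun (fun Phi : L2 R Y' => [ffun z : fZ => Phi (lift_hom z)] : L2 R Z').

Lemma restrE Phi (z : fZ) : restr Phi z = Phi (lift_hom z).
Proof. by rewrite linfunE ?ffunE // => c f g; apply/ffunP=> y; rewrite !ffunE. Qed.

Lemma restr_inj : {in CSS beta N R X &, injective restr}.
Proof.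
move=> Phi Psi /CSSP[s1 c1] /CSSP[s2 c2] e12; apply/ffunP=> b.
have [bNp|nb] := boolP (limg (b : Y') <= Np)%VS; last first.
  have -> : Phi b = 0 by apply/eqP; apply: contraNT nb => /s1.
  by apply/esym/eqP; apply: contraNT nb => /s2.
have bN := lift_proj bNp.
rewrite (c1 _ (lift_hom (proj_hom b) : fY) bN) (c2 _ (lift_hom (proj_hom b) : fY) bN).
by rewrite -!restrE e12.
Qed.

Lemma restr_surj Psi : exists2 Phi, Phi \in CSS beta N R X & restr Phi = Psi.
Proof.
pose Phi : L2 R Y' :=
  [ffun b : fY => if (limg (b : Y') <= Np)%VS then Psi (proj_hom b) else 0].
exists Phi; last first.
  by apply/ffunP=> z; rewrite restrE ffunE lift_perp liftK.
apply/CSSP; split=> [b|b b' bN]; rewrite !ffunE; first by case: ifP; rewrite ?eqxx.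
by rewrite (proj_hom_congr bN) (perp_congr bN).
Qed.

Definition intertwined (M : 'End(L2 R Y')) (M' : 'End(L2 R Z')) : Prop :=
  forall Phi, Phi \in CSS beta N R X ->
    M Phi \in CSS beta N R X /\ restr (M Phi) = M' (restr Phi).

Lemma intertwined_comp M1 M2 M1' M2' :
  intertwined M1 M1' -> intertwined M2 M2' ->
  intertwined (M1 \o M2)%VF (M1' \o M2')%VF.
Proof.
move=> h1 h2 Phi PC; have [C2 e2] := h2 _ PC; have [C1 e1] := h1 _ C2.
by rewrite !comp_lfunE e1 e2.
Qed.

Lemma intertwined_diag (M : 'End(L2 R Y')) (M' : 'End(L2 R Z'))
    (c : Y' -> R[i]) (c' : Z' -> R[i]) :
  (forall b, M (delta R b) = c b *: delta R b) ->
  (forall z, M' (delta R z) = c' z *: delta R z) ->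
  (forall b, (limg b <= Np)%VS -> c b = c' (proj_hom b)) ->
  intertwined M M'.
Proof.
move=> ME ME' cc Phi /CSSP[s1 c1].
have E b : M Phi b = if (limg (b : Y') <= Np)%VS then c' (proj_hom b) * Phi b else 0.
  rewrite (L2_diag _ _ ME); case: ifP => [/cc->//|nb].
  suff -> : Phi b = 0 by rewrite mulr0.
  by apply/eqP; apply: contraFT nb => /s1.
split; last by apply/ffunP=> z; rewrite restrE E lift_perp liftK (L2_diag _ _ ME') restrE.
apply/CSSP; split=> [b|b b' bN].
  by rewrite E; case: ifP; rewrite ?eqxx.
rewrite !(L2_diag _ _ ME) (c1 _ _ bN).
have [->|nz] := eqVneq (Phi b') 0; first by rewrite !mulr0.
have nz1 : Phi b != 0 by rewrite (c1 _ _ bN).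
by rewrite !cc ?s1 // (proj_hom_congr bN).
Qed.

Lemma intertwined_perm (M : 'End(L2 R Y')) (M' : 'End(L2 R Z')) (c : R[i])
    (k : Y' -> Y') (k' : Z' -> Z') :
  (forall b, M (delta R b) = c *: delta R (k b)) ->
  (forall z, M' (delta R z) = c *: delta R (k' z)) ->
  bijective k -> bijective k' ->
  (forall b, (limg b <= Np)%VS -> (limg (k b) <= Np)%VS) ->
  (forall b b', (limg (k b - k b')%R <= N)%VS = (limg (b - b')%R <= N)%VS) ->
  (forall b, (limg b <= Np)%VS -> proj_hom (k b) = k' (proj_hom b)) ->
  intertwined M M'.
Proof.
move=> ME ME' bk bk' kNp kN kproj Phi PC; have [s1 c1] := CSSP _ PC.
have [ki _ kiK] := bk; have [ki' _ kiK'] := bk'.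
have E (b : fY) : M Phi (k b) = c * Phi b by apply: L2_perm ME; apply: bij_inj.
have E' (b : fY) : M Phi b = c * Phi (ki b) by rewrite -E kiK.
have MC : M Phi \in CSS beta N R X.
  apply/CSSP; split=> [b|b b' bN].
    by rewrite E' mulf_eq0 negb_or => /andP[_ /s1/kNp]; rewrite kiK.
  by rewrite (E' b) (E' b'); congr (c * _); apply: c1; rewrite -kN !kiK.
split=> //; apply/ffunP=> z; rewrite restrE -(kiK' z); set z1 := ki' z.
rewrite (L2_perm _ _ (bij_inj bk') ME') restrE -E; have [_ c2] := CSSP _ MC.
apply: c2.
have -> : k' z1 = proj_hom (k (lift_hom z1)) by rewrite kproj ?lift_perp ?liftK.
rewrite -opprB -[(limg (- _) <= _)%VS]/(limg (- _)%R <= N)%VS.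
apply/limg_subP=> x; rewrite opp_lfunE rpredN; move: x; apply/limg_subP.
exact/lift_proj/kNp/lift_perp.
Qed.

Definition card_N : nat := #|[pred b : fY | (limg (b : Y') <= N)%VS]|.

Lemma card_N_neq0 : (card_N%:R : R[i]) != 0.
Proof.
rewrite pnatr_eq0 -lt0n; apply/card_gt0P; exists (0 : Y'); rewrite inE.
by apply/limg_subP=> x; rewrite zero_lfunE mem0v.
Qed.

(** Hom(X, N^perp) is the disjoint union of the cosets lift_hom z + Hom(X, N). *)
Lemma sum_cosets (h : fY -> R[i]) :
  (forall b, h b != 0 -> (limg (b : Y') <= Np)%VS) ->
  (forall b b' : fY, (limg ((b : Y') - b')%R <= N)%VS -> h b = h b') ->
  \sum_b h b = card_N%:R * \sum_(z : fZ) h (lift_hom z).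
Proof.
move=> h1 h2; rewrite (bigID (fun b : fY => (limg (b : Y') <= Np)%VS)) /=.
rewrite [X in _ + X]big1 ?addr0 => [|b nb]; last first.
  by apply/eqP; apply: contraNT nb => /h1.
rewrite (partition_big (fun b : fY => proj_hom b : fZ) predT) //= mulr_sumr.
apply: eq_bigr => z _; rewrite (reindex_onto (fun b : fY => (lift_hom z + b : Y') : fY)
  (fun b : fY => ((b : Y') - lift_hom z)%R : fY)) /=; last first.
  by move=> b _; rewrite addrC subrK.
rewrite (eq_bigl [pred b : fY | (limg (b : Y') <= N)%VS]) => [|b]; last first.
  rewrite inE addrAC subrr add0r eqxx andbT.
  apply/andP/limg_subP => [[bNp /eqP bz] x|bN]; last split.
  - have := limg_subP _ _ (lift_proj bNp) x; rewrite bz.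
    by rewrite !add_lfunE opp_lfunE addrAC subrr add0r.
  - apply/limg_subP=> x; rewrite add_lfunE rpredD ?(subvP N_iso _ (bN x)) //.
    exact: (limg_subP _ _ (lift_perp z)).
  - apply/eqP; rewrite -[RHS]liftK; apply: proj_hom_congr; apply/limg_subP=> x.
    by rewrite !add_lfunE opp_lfunE addrAC subrr add0r.
rewrite (eq_bigr (fun=> h (lift_hom z))) => [|b bN]; last first.
  by apply: h2; rewrite addrAC subrr add0r.
by rewrite sumr_const mulr_natl.
Qed.

Variables (Y Z : vectType F) (prU : Y -> Y' -> F) (prW : Z -> Z' -> F).
Variables (tXU : U -> X -> Y) (tXdU : U -> Xd -> Y').
Variables (tXW : W -> X -> Z) (tXdW : W -> Xd -> Z').
Variable actU : 'End(U) -> 'End((X * Xd)%type) -> 'End((Y * Y')%type).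
Variable actW : 'End(W) -> 'End((X * Xd)%type) -> 'End((Z * Z')%type).
Hypothesis tU : tensor_action beta ev prU tXU tXdU actU.
Hypothesis tW : tensor_action beta' ev prW tXW tXdW actW.

Let prUP : bilinear_pairing prU. Proof. by case: tU => -[]. Qed.

Section Shears.
Variables (A : 'Hom(Xd, X)) (At : 'Hom(Y', Y)) (At' : 'Hom(Z', Z)).
Hypothesis AtE : forall b b', prU (At b) b' = \sum_i beta (b (e i)) (b' (A (e' i))).
Hypothesis AtE' : forall z z', prW (At' z) z' = \sum_i beta' (z (e i)) (z' (A (e' i))).

Lemma shear_proj b b' : (limg b <= Np)%VS -> (limg b' <= Np)%VS ->
  prU (At b) b' = prW (At' (proj_hom b)) (proj_hom b').
Proof.
move=> /limg_subP bN /limg_subP b'N; rewrite AtE AtE'; apply: eq_bigr => i _.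
by rewrite !projE Pbeta.
Qed.

Lemma shear_N b b' : (limg b <= N)%VS -> (limg b' <= Np)%VS -> prU (At b) b' = 0.
Proof.
move=> /limg_subP bN /limg_subP b'N; rewrite AtE big1 // => i _.
by rewrite (beta_NNp (N := N)).
Qed.
End Shears.

Section Fourier.
Variables (B : 'Hom(Xd, X)) (Bt : 'Hom(Y', Y)) (Bt' : 'Hom(Z', Z)).
Hypotheses (iB : invertible_map B) (sB : sym_map prU Bt)
  (BX : forall u f, Bt (tXdU u f) = tXU u (B f))
  (BtE : forall b b', prU (Bt b) b' = \sum_i beta (b (e i)) (b' (B (e' i))))
  (BtE' : forall z z', prW (Bt' z) z' = \sum_i beta' (z (e i)) (z' (B (e' i)))).

(** If b x is not orthogonal to some v in N, the map G = v (x) f with B f = x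
    pairs nontrivially with b; scaling G reaches any value of the character. *)
Lemma detect_perp b : ~~ (limg b <= Np)%VS ->
  exists2 G : Y', (limg G <= N)%VS & w (prU (Bt G) b) != 1.
Proof.
move/subvPn=> [_ /memv_imgP[x _ ->] /mem_orthovPn[v vN]].
rewrite symmC => nz; have [a a1] := omega_nontrivial R pF.
pose c := beta v (b x); pose G := (a / c) *: tXdU v ((B^-1)%VF x).
have [_ _ _ tXdE _] := tU.
exists G; first by apply/limg_subP=> y; rewrite scale_lfunE tXdE !memvZ.
rewrite /G linearZ /= BX (prZl prUP) invertible_mapVK //.
by rewrite (pr_tX tU ee) -/c divfK.
Qed.

(** Translation by a G with character value different from 1 multiplies the sum
    by this value. *)
Lemma character_sum_N b : ~~ (limg b <= Np)%VS ->
  \sum_(G : fY | (limg (G : Y') <= N)%VS) w (prU (Bt G) b) = 0.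
Proof.
move=> /detect_perp[G0 G0N nz]; set S := \sum_(G : fY | _) _.
have SE : S = w (prU (Bt G0) b) * S.
  rewrite {1}/S (reindex_inj (addrI (G0 : fY))) mulr_sumr.
  apply: eq_big => [G|G _]; last by rewrite linearD (prDl prUP) omegaD.
  apply/limg_subP/limg_subP=> h x; have := h x; rewrite add_lfunE => hx.
    by rewrite -[G x](addKr (G0 x)) rpredD // rpredN (limg_subP _ _ G0N).
  by rewrite rpredD // (limg_subP _ _ G0N).
have /eqP : (1 - w (prU (Bt G0) b)) * S = 0 by rewrite mulrBl mul1r -SE subrr.
by rewrite mulf_eq0 subr_eq0 eq_sym (negPf nz) => /eqP.
Qed.

Lemma two_neq0 : (2%:R : F) != 0.
Proof.
apply/negP=> /eqP two0; have := dvdn_pcharf pF 2; rewrite two0 eqxx.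
move/dvdn_leq => /(_ isT); rewrite leq_eqVlt ltnS leqNgt.
rewrite prime_gt1 ?(pcharf_prime pF) // orbF => /eqP p2.
by move: p_odd; rewrite p2.
Qed.

(** The terms of the Gauss sum outside Hom(X, N^perp) cancel along the cosets
    of Hom(X, N); those inside are constant along these cosets. *)
Lemma gamma_proj : gamma R pF prU Bt = card_N%:R * gamma R pF prW Bt'.
Proof.
pose q b := - (2%:R^-1 * prU (Bt b) b).
have qG b G : (limg G <= N)%VS -> q (b + G) = q b + prU (Bt G) (- b).
  move=> GN; rewrite /q linearD !(prDl prUP, prDr prUP) (sB b G) (prNr prUP).
  rewrite (shear_N BtE GN (subv_trans GN N_iso)).
  by rewrite /=; field; apply: two_neq0.
(* card_N copies of S, translated by the elements of Hom(X, N), are summed over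
   these translations before they are summed over b. *)
pose S := \sum_(b : fY | ~~ (limg (b : Y') <= Np)%VS) w (q b).
have S0 : S = 0.
  apply: (mulfI card_N_neq0); rewrite mulr0 mulr_natl -sumr_const /=.
  rewrite (eq_bigr (fun G : fY => \sum_(b : fY | ~~ (limg (b : Y') <= Np)%VS)
      w (q b) * w (prU (Bt G) (- (b : Y'))))); last first.
    move=> G; rewrite inE => GN; rewrite /S (reindex_inj (addIr (G : fY))).
    apply: eq_big => [b|b _].
      by congr (~~ _); apply: perp_congr; rewrite addrAC subrr add0r.
    by rewrite (qG b G GN) omegaD.
  rewrite exchange_big big1 //= => b nb; rewrite -mulr_sumr.
  rewrite (character_sum_N (b := - (b : Y'))) ?mulr0 //.
  apply: contra nb => /limg_subP nb; apply/limg_subP=> x.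
  by have := nb x; rewrite opp_lfunE rpredN.
rewrite /gamma (bigID (fun b : fY => (limg (b : Y') <= Np)%VS)) /=.
rewrite -/S [X in _ + X]S0 addr0.
rewrite big_mkcond /= (sum_cosets
  (h := fun b : fY => if (limg (b : Y') <= Np)%VS then w (q b) else 0)).
- congr (_ * _); apply: eq_bigr => z _; rewrite lift_perp /q.
  by rewrite (shear_proj BtE BtE') ?lift_perp // liftK.
- by move=> b; case: ifP; rewrite ?eqxx.
- move=> b b' bN; rewrite (perp_congr bN); case: ifP => // b'N.
  have -> : b = (b' : Y') + ((b : Y') - b') by rewrite addrC subrK.
  rewrite qG // omegaD.
  rewrite (shear_N BtE bN) ?omega0 ?mulr1 //.
  by move/limg_subP: b'N => h; apply/limg_subP=> x; rewrite opp_lfunE rpredN.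
Qed.

Lemma intertwined_fourier (M : 'End(L2 R Y')) (M' : 'End(L2 R Z')) :
  (forall b, M (delta R b) = (gamma R pF prU Bt)^-1 *:
     \sum_(b' : fY) w (prU (Bt b) b') *: delta R b') ->
  (forall z, M' (delta R z) = (gamma R pF prW Bt')^-1 *:
     \sum_(z' : fZ) w (prW (Bt' z) z') *: delta R z') ->
  intertwined M M'.
Proof.
move=> ME ME' Phi /CSSP[s1 c1].
have E (b : fY) : M Phi b = if (limg (b : Y') <= Np)%VS then
    (gamma R pF prW Bt')^-1
      * \sum_(z : fZ) w (prW (Bt' z) (proj_hom b)) * restr Phi z else 0.
  rewrite (L2_kernel _ _ ME); case: ifP => bN.
    rewrite (sum_cosets (h := fun y : fY => w (prU (Bt y) b) * Phi y)).
    - rewrite gamma_proj invfM -mulrA mulrCA mulKf ?card_N_neq0 //.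
      congr (_ * _); apply: eq_bigr => z _.
      by rewrite (shear_proj BtE BtE') ?lift_perp // liftK restrE.
    - by move=> y; rewrite mulf_eq0 negb_or => /andP[_ /s1].
    - move=> y y' yN; rewrite (c1 _ _ yN); congr (w _ * _).
      apply/subr0_eq; rewrite -(prNl prUP) -(prDl prUP) -linearB.
      by rewrite /=; apply: (shear_N BtE yN bN).
  (* Translating the sum by G multiplies it by a nontrivial character value. *)
  have [G GN nz] := detect_perp (negbT bN).
  set S := \sum_y _; suff -> : S = 0 by rewrite mulr0.
  have SE : S = w (prU (Bt G) b) * S.
    rewrite {1}/S (reindex_inj (addrI (G : fY))) mulr_sumr.
    apply: eq_bigr => y _; rewrite linearD (prDl prUP) omegaD -mulrA.
    congr (_ * (_ * _)); apply: c1; rewrite addrK //.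
  have /eqP : (1 - w (prU (Bt G) b)) * S = 0 by rewrite mulrBl mul1r -SE subrr.
  by rewrite mulf_eq0 subr_eq0 eq_sym (negPf nz) => /eqP.
split.
  apply/CSSP; split=> [b|b b' bN]; first by rewrite E; case: ifP; rewrite ?eqxx.
  by rewrite !E (proj_hom_congr bN) (perp_congr bN).
by apply/ffunP=> z; rewrite restrE E lift_perp liftK (L2_kernel _ _ ME').
Qed.
End Fourier.

Section Oscillators.
Variables (mu : 'End((Y * Y')%type) -> 'End(L2 R Y')).
Variables (mu' : 'End((Z * Z')%type) -> 'End(L2 R Z')).
Hypotheses (omu : oscillator pF prU mu) (omu' : oscillator pF prW mu').
Hypothesis dimUW : (\dim {:W} + 2 * \dim N)%N = \dim {:U}.

Lemma OrthN_mem g x : OrthN beta N g -> (g x \in N) = (x \in N).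
Proof.
move=> gN; apply/idP/idP=> [|xN]; last exact: (OrthN_N gN).
case: gN => -[kg _] gN; rewrite -{1}gN => /memv_imgP[y yN].
by have /eqP/lker0P ginj := kg; move/ginj->.
Qed.

(** The determinants on the two sides differ by the square of det C ^ dim N,
    to which ell is blind. *)
Lemma intertwined_D g g' C Ct :
  OrthN beta N g -> OrthG beta' g' -> lfun_det g = lfun_det g' ->
  (forall x, x \in Np -> g' (P x) = P (g x)) ->
  invertible_map C -> contragredient ev C Ct ->
  intertwined (mu (actU g (D_ C Ct))) (mu' (actW g' (D_ C Ct))).
Proof.
move=> gN og' dg gP iC kC; have [og _] := gN.
have [L [Rt [iL kL -> dL RE]]] := act_D tU evP ee og iC kC.
have [L' [Rt' [iL' kL' -> dL' RE']]] := act_D tW evP ee og' iC kC.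
have [_ _ _ muD _] := omu; have [_ _ _ muD' _] := omu'.
have ME := muD _ _ iL kL; have ME' := muD' _ _ iL' kL'.
have ellE : ell R (lfun_det L) = ell R (lfun_det L').
  rewrite dL dL' -dg -dimUW exprD mulrA mulrC mulnC exprM ell_square //.
  by rewrite expf_neq0 // lfun_det_neq0.
rewrite -ellE in ME'.
have CK := invertible_mapVK iC.
have bij (V : vectType F) (h : 'End(V)) (K : 'End('Hom(X, V))) : invertible_map h ->
    (forall b x, K b (C x) = h (b x)) -> bijective K.
  move=> ih KE; exists (fun b : 'Hom(X, V) => (h^-1 \o b \o C)%VF) => b; apply/lfunP=> x.
    by rewrite !comp_lfunE /= KE invertible_mapK.
  by rewrite -(CK x) KE !comp_lfunE /= (invertible_mapVK ih).
apply: (intertwined_perm ME ME').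
- by apply: bij RE; apply: inj_endo_invertible; case: og.
- by apply: bij RE'; apply: inj_endo_invertible; case: og'.
- move=> b /limg_subP bN; apply/limg_subP=> x; rewrite -(CK x) RE.
  exact: (OrthN_perp gN).
- move=> b b'; apply/limg_subP/limg_subP=> h x.
    have := h (C x); rewrite !add_lfunE !opp_lfunE !RE -linearB OrthN_mem //.
  rewrite -(CK x) !add_lfunE !opp_lfunE !RE -linearB OrthN_mem //.
  by have := h ((C^-1)%VF x); rewrite add_lfunE opp_lfunE.
- move=> b /limg_subP bN; apply/lfunP=> x.
  by rewrite -(CK x) projE RE RE' projE gP.
Qed.

Lemma intertwined_1 S : Sp ev S ->
  intertwined (mu (actU \1%VF S)) (mu' (actW \1%VF S)).
Proof.
have [_ muM muN _ muJ] := omu; have [_ muM' muN' _ muJ'] := omu'.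
have O1 := OrthG1 beta; have O1' := OrthG1 beta'.
move=> SS; apply: (Sp_generated evP ee
  (Q := fun S => intertwined (mu (actU \1%VF S)) (mu' (actW \1%VF S)))) SS
  => {S} [S S' SS SS' QS QS'|A sA|C Ct iC kC|B sB iB].
- have := act_comp tU \1 \1 S S'; have := act_comp tW \1 \1 S S'.
  rewrite !comp_lfun1l => -> ->.
  rewrite (muM _ _ (act_Sp tU O1 SS) (act_Sp tU O1 SS')).
  rewrite (muM' _ _ (act_Sp tW O1' SS) (act_Sp tW O1' SS')).
  exact: intertwined_comp QS QS'.
- have [At [At1 At2]] := act_shear tU ee A.
  have [At' [At1' At2']] := act_shear tW ee A.
  rewrite (act_N tU At1) (act_N tW At1').
  have ME := muN _ (act_N_sym tU evP ee At1 sA).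
  have ME' := muN' _ (act_N_sym tW evP ee At1' sA).
  apply: (intertwined_diag ME ME') => b bN.
  by rewrite (shear_proj At2 At2' bN bN).
- apply: intertwined_D => //; first by split=> //; rewrite lim1g.
  + by rewrite !lfun_det_id.
  + by move=> x _; rewrite !id_lfunE.
- have [Bt [B1 B2]] := act_shear tU ee B; have [Bt' [B1' B2']] := act_shear tW ee B.
  have [iBt ->] := act_J tU evP ee iB B1; have [iBt' ->] := act_J tW evP ee iB B1'.
  have sBt := act_N_sym tU evP ee B1 sB; have sBt' := act_N_sym tW evP ee B1' sB.
  exact: (intertwined_fourier iB sBt B1 B2 B2' (muJ _ sBt iBt) (muJ' _ sBt' iBt')).
Qed.

(** The operator g (x) S is the product of g (x) 1 and of 1 (x) S, and the
    former is g (x) D_1. *)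
Theorem CSS_intertwined g g' S :
  OrthN beta N g -> OrthG beta' g' -> lfun_det g = lfun_det g' ->
  (forall x, x \in Np -> g' (P x) = P (g x)) -> Sp ev S ->
  intertwined (mu (actU g S)) (mu' (actW g' S)).
Proof.
move=> gN og' dg gP SS; have [og _] := gN.
have [_ muM _ _ _] := omu; have [_ muM' _ _ _] := omu'.
have k1 : contragredient ev \1%VF \1%VF by move=> x f; rewrite !id_lfunE.
have i1 : invertible_map (\1 : 'End(X))%VF 
  by apply: inj_endo_invertible; apply/eqP/lker0P=> x y; rewrite !id_lfunE.
have D1 : D_ \1%VF \1%VF = \1%VF :> 'End((X * Xd)%type).
  by apply/lfunP=> -[x f]; rewrite D_E !id_lfunE.
have S1 := Sp_D evP ee k1; have h1 := intertwined_D gN og' dg gP i1 k1.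
have := act_comp tU g \1 (D_ \1 \1) S; have := act_comp tW g' \1 (D_ \1 \1) S.
rewrite D1 !comp_lfun1r comp_lfun1l => -> ->; rewrite D1 in h1 S1.
rewrite (muM _ _ (act_Sp tU og S1) (act_Sp tU (OrthG1 beta) SS)).
rewrite (muM' _ _ (act_Sp tW og' S1) (act_Sp tW (OrthG1 beta') SS)).
exact: intertwined_comp h1 (intertwined_1 SS).
Qed.
End Oscillators.
End Reduction.

(** * The reduction of the oscillator representation *)

Theorem lemma2p7 (R : realType) (F : finFieldType) (p : nat)
    (pF : p \in [pchar F]) (p_odd : odd p)
    (X U : vectType F) (beta : {symmetric U}) (beta_nd : nondegenerate beta)
    (N : {vspace U}) (N_iso : (N <= perp beta N)%VS) :
  exists beta' : {symmetric (perpq beta N)},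
  [/\ [/\ forall x y : subvs_of (perp beta N),
            beta' (pi_perp x) (pi_perp y) = beta (vsval x) (vsval y),
          nondegenerate beta',
          (\dim {: perpq beta N} + 2 * \dim N)%N = \dim {: U}
        & forall (e : (\dim {: U}).-tuple U)
                 (e' : (\dim {: perpq beta N}).-tuple (perpq beta N)),
            basis_of {: U} e -> basis_of {: perpq beta N} e' ->
            [/\ \det (gram beta e) != 0, \det (gram beta' e') != 0
              & same_square_class (\det (gram beta' e'))
                                  ((-1) ^+ \dim N * \det (gram beta e))]],
      [/\ forall g, OrthN beta N g -> forall x : subvs_of (perp beta N),
            g (vsval x) \in perp beta N /\
            induced beta N g (pi_perp x)
              = pi_perp (vsproj (perp beta N) (g (vsval x))),
          induced beta N \1%VF = \1%VF,
          forall g h, OrthN beta N g -> OrthN beta N h ->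
            induced beta N (g \o h)%VF
              = (induced beta N g \o induced beta N h)%VF
        & forall g' : 'End(perpq beta N),
            (exists2 g, OrthN beta N g & induced beta N g = g')
            <-> OrthG beta' g']
    & forall
        (mu : 'End(('Hom(dual X, U) * 'Hom(X, U))%type) ->
              'End(L2 R 'Hom(X, U)))
        (mu' : 'End(('Hom(dual X, perpq beta N) * 'Hom(X, perpq beta N))%type)
               -> 'End(L2 R 'Hom(X, perpq beta N))),
        oscillator pF (tens_pair X beta) mu ->
        oscillator pF (tens_pair X beta') mu' ->
        (forall g S, OrthN beta N g -> Sp (evp X) S ->
           forall Phi, Phi \in CSS beta N R X ->
             mu (tens_act g S) Phi \in CSS beta N R X) /\
        exists T : 'Hom(L2 R 'Hom(X, U), L2 R 'Hom(X, perpq beta N)),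
          [/\ {in CSS beta N R X &, injective T},
              forall Psi, exists2 Phi, Phi \in CSS beta N R X & T Phi = Psi
            & forall g S, OrthN beta N g -> Sp (evp X) S ->
                forall Phi, Phi \in CSS beta N R X ->
                  T (mu (tens_act g S) Phi)
                    = mu' (tens_act (induced beta N g) S) (T Phi)]].
Proof.
have [beta' b'E] := quotient_form_exists N_iso.
have [s [P sP]] := isometric_section_exists b'E beta_nd.
have dimU := quotient_dim N_iso b'E beta_nd sP.
exists beta'; split.
- split=> //; first exact: quotient_nondegenerate b'E beta_nd.
  move=> e e' be be'; split.
  + exact: gram_det_neq0.
  + exact: gram_det_neq0 (quotient_nondegenerate b'E beta_nd) be'.
  + exact: (quotient_discriminant N_iso b'E beta_nd sP).
- split=> [g gN x|| g h gN hN|g'].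
  + split; first by apply: (OrthN_perp gN); apply: subvsP.
    exact: (induced_pi_perp N_iso sP gN).
  + exact: (induced_id N_iso beta_nd sP).
  + by have [] := induced_comp N_iso beta_nd sP gN hN.
  + split=> [[g gN <-]|]; first exact: (induced_OrthG N_iso b'E beta_nd sP gN).
    exact: (induced_surj N_iso beta_nd sP).
move=> mu mu' omu omu'.
have main g S (gN : OrthN beta N g) := @CSS_intertwined R F p pF
  p_odd X (dual X) (evp X) _ _ _ (evp_pairing X) (evp_dual_bases X)
  U (perpq beta N) beta beta' N s P N_iso
  (section_perp sP) (sectionK sP) (section_N N_iso sP) (section_sub sP)
  (section_beta b'E sP) _ _ _ _ _ _ _ _ _ _
  (tens_act_tensor_action X beta) (tens_act_tensor_action X beta') mu mu' omu omu'
  dimU g _ S gN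
  (induced_OrthG N_iso b'E beta_nd sP gN) (lfun_det_induced N_iso b'E beta_nd sP gN)
  (induced_P N_iso sP gN).
split; first exact: (fun g S gN SS Phi PC => proj1 (main g S gN SS Phi PC)).
exists (restr R X s); split.
- exact: restr_inj (section_sub sP).
- exact: restr_surj N_iso (section_perp sP) (sectionK sP) (section_N N_iso sP).
- exact: (fun g S gN SS Phi PC => proj2 (main g S gN SS Phi PC)).
Qed.
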